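(* Let $A\in\mathbb{C}^{m\times n}$ and $b\in\mathbb{C}^m$, let $\varepsilon,\eta\in(0,1)$, and let $k\ge 1$ be an integer and $\kappa>0$ a real number. Suppose that $A$ has rank at most $k$, $\|A\|\le 1$, $\|A^+\|\le\kappa$, and that the orthogonal projection of $b$ onto the column space of $A$ has norm $\Omega(\|b\|)$ (i.e. at least $c_0\|b\|$ for a fixed absolute constant $c_0>0$). Then Algorithm 1 (described in the context) solves $Ax=b$ up to $\varepsilon$-multiplicative accuracy: with probability at least $1-\eta$, its output vector $\tilde{x}$ satisfies $$\|\tilde{x}-A^+b\|\le\varepsilon\|A^+b\|.$$
   Context: $\|\cdot\|$ denotes the Euclidean norm of vectors and the operator norm of matrices, $\|\cdot\|_F$ the Frobenius norm, $A^\dagger$ the conjugate transpose, $A^+$ the Moore–Penrose pseudoinverse, $A_{i.}$ the $i$-th row and $A_{.j}$ the $j$-th column of $A$. Algorithm 1 (low-rank stochastic regression via length-square sampling). Input: $b\in\mathbb{C}^m$, $A\in\mathbb{C}^{m\times n}$ with $\|A\|\le1$, $\operatorname{rank}(A)=k$, $\|A^+\|\le\kappa$, accuracy $\varepsilon$ and failure probability $\eta$. 1. Set $r=2^{10}\ln(8n/\eta)\,\kappa^4k^2\|A\|_F^2/\varepsilon^2$ and $c=2^6\cdot3^4\ln(8r/\eta)\,\kappa^8k^2\|A\|_F^2/\varepsilon^2$. 2. Sample $r$ row indices $i_1,\dots,i_r$ independently, each equal to $i$ with probability $\|A_{i.}\|^2/\|A\|_F^2$. Let $R\in\mathbb{C}^{r\times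 n}$ be the matrix whose $s$-th row is $\frac{\|A\|_F}{\sqrt r}\frac{A_{i_s.}}{\|A_{i_s.}\|}$. 3. Sample $c$ column indices $j_1,\dots,j_c$ independently, each as follows: pick $s\in[r]$ uniformly, then pick $j$ with probability $|R_{sj}|^2/\|R_{s.}\|^2=|A_{i_sj}|^2/\|A_{i_s.}\|^2$. Let $C\in\mathbb{C}^{r\times c}$ be the matrix whose $t$-th column is $\frac{\|A\|_F}{\sqrt c}\frac{R_{.j_t}}{\|R_{.j_t}\|}$. 4. Compute the left singular vectors $w^{(1)},\dots,w^{(k)}\in\mathbb{C}^r$ of $C$ and the corresponding singular values $\tilde\sigma_1,\dots,\tilde\sigma_k$. 5. Implicitly define $\tilde v^{(\ell)}:=R^\dagger w^{(\ell)}/\tilde\sigma_\ell\in\mathbb{C}^n$ for $\ell\in[k]$. 6. For each $\ell\in[k]$ compute a number $\tilde\lambda_\ell$ with $|\tilde\lambda_\ell-\langle\tilde v^{(\ell)},A^\dagger b\rangle|=O\!\left(\varepsilon\tilde\sigma_\ell^2\|b\|/\sqrt k\right)$ (i.e. at most a sufficiently small absolute constant times $\varepsilon\tilde\sigma_\ell^2\|b\|/\sqrt k$). 7. Output the row indices $i_1,\dots,i_r$ and $w:=\sum_{\ell=1}^k\frac{\tilde\lambda_\ell}{\tilde\sigma_\ell^3}w^{(\ell)}\in\mathbb{C}^r$; the approximate solution is $\tilde x:=R^\dagger w\in\mathbb{C}^n$. *)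

(* Defs.v *)
From mathcomp Require Import all_boot all_order all_algebra.
From mathcomp Require Import boolp classical_sets reals exp.
From mathcomp Require Import complex.

Set Implicit Arguments.
Unset Strict Implicit.
Unset Printing Implicit Defensive.

Import Order.TTheory GRing.Theory Num.Theory.

Local Open Scope classical_set_scope.
Local Open Scope ring_scope.
Local Open Scope complex_scope.
Local Open Scope sesquilinear_scope.

Notation cabs := ComplexField.Normc.normc (only parsing).

Section LinearAlgebra.
Context {R : realType}.
Local Notation C := R[i].

(* On a row or column vector this is the Euclidean norm.  (The norm [`|A|] that
   the library puts on matrices is the entrywise maximum.) *)
Definition fnorm m n (A : 'M[C]_(m, n)) : R :=
  Num.sqrt (\sum_i \sum_j cabs (A i j) ^+ 2).

Definition opnorm m n (A : 'M[C]_(m, n)) : R :=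
  sup [set fnorm (A *m x) | x in [set x : 'cV[C]_n | fnorm x <= 1]].

(* Conjugate-linear in the first argument. *)
Definition inner n (u v : 'cV[C]_n) : C := (u^t* *m v) ord0 ord0.

(* X is the Moore-Penrose pseudoinverse of A, given by the four Penrose
   equations.  (The library's [pinvmx] only satisfies the first one.) *)
Definition is_pinv m n (A : 'M[C]_(m, n)) (X : 'M[C]_(n, m)) : Prop :=
  [/\ A *m X *m A = A, X *m A *m X = X,
      (A *m X)^t* = A *m X & (X *m A)^t* = X *m A].

Definition is_orth_proj m n (A : 'M[C]_(m, n)) (b p : 'cV[C]_m) : Prop :=
  (exists y : 'cV[C]_n, p = A *m y) /\
  (forall y : 'cV[C]_n, inner (A *m y) (b - p) = 0).

(* Full singular value decomposition M = U Sigma V^dagger.  The singular values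
   are sigma 0 >= sigma 1 >= ..., extended by 0 beyond min(r, c); column l of U
   is the left singular vector for sigma l. *)
Definition is_svd r c (M : 'M[C]_(r, c))
    (U : 'M[C]_r) (sigma : nat -> R) (V : 'M[C]_c) : Prop :=
  [/\ U \is unitarymx, V \is unitarymx,
      (forall i j, (i <= j)%N -> sigma j <= sigma i),
      (forall i, 0 <= sigma i) /\
        (forall i, (minn r c <= i)%N -> sigma i = 0) &
      M = U *m (\matrix_(i < r, j < c)
                  if i == j :> nat then (sigma i)%:C else 0) *m V^t*].

End LinearAlgebra.

Section Algorithm.
Context {R : realType}.
Local Notation C := R[i].

(* The real-valued sample counts are rounded up; both are nonnegative whenever
   0 < eta < 1, so [absz] does not alter them. *)
Definition num_rows m n (A : 'M[C]_(m, n)) (k : nat) (kappa eps eta : R) : nat :=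
  `|Num.ceil (2 ^+ 10 * ln (8 * n%:R / eta) * kappa ^+ 4 * k%:R ^+ 2
              * fnorm A ^+ 2 / eps ^+ 2)|%N.

Definition num_cols m n (A : 'M[C]_(m, n)) (k : nat) (kappa eps eta : R) : nat :=
  `|Num.ceil (2 ^+ 6 * 3 ^+ 4 * ln (8 * (num_rows A k kappa eps eta)%:R / eta)
              * kappa ^+ 8 * k%:R ^+ 2 * fnorm A ^+ 2 / eps ^+ 2)|%N.

Definition row_prob m n (A : 'M[C]_(m, n)) (i : 'I_m) : R :=
  fnorm (row i A) ^+ 2 / fnorm A ^+ 2.

Definition row_sketch m n (A : 'M[C]_(m, n)) r (I : {ffun 'I_r -> 'I_m})
    : 'M[C]_(r, n) :=
  \matrix_(s, j) ((fnorm A / Num.sqrt r%:R / fnorm (row (I s) A))%:C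
                  * A (I s) j).

(* Law of a column index: s is uniform on 'I_r, then j is drawn with probability
   |Rs s j|^2 / |row s Rs|^2. *)
Definition col_prob r n (Rs : 'M[C]_(r, n)) (j : 'I_n) : R :=
  \sum_(s < r) r%:R^-1 * (cabs (Rs s j) ^+ 2 / fnorm (row s Rs) ^+ 2).

(* [a] is the Frobenius norm of the original matrix A, not of Rs. *)
Definition col_sketch r n (a : R) (Rs : 'M[C]_(r, n)) c
    (J : {ffun 'I_c -> 'I_n}) : 'M[C]_(r, c) :=
  \matrix_(s, t) ((a / Num.sqrt c%:R / fnorm (col (J t) Rs))%:C * Rs s (J t)).

(* x is a possible output Rs^dagger w of the low-rank length-square sampling
   algorithm for A x = b once the row indices I and the column indices J have
   been drawn: the singular value decomposition of the sketch and the estimates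
   lambda are only constrained by their specification, with delta the absolute
   constant in the precision of lambda.  Only indices l < k matter; when A != 0,
   |A| <= 1 and |A^+| <= kappa, the row count r = num_rows A k kappa eps eta is
   at least k.  If rank A < k then some sigma l with l < k vanishes; as 0^-1 = 0,
   the corresponding v l and term of w are 0. *)
Definition possible_output m n (A : 'M[C]_(m, n)) (b : 'cV[C]_m)
    (k : nat) (eps delta : R) r c
    (I : {ffun 'I_r -> 'I_m}) (J : {ffun 'I_c -> 'I_n}) (x : 'cV[C]_n) : Prop :=
  let Rs := row_sketch A I in
  let Cs := col_sketch (fnorm A) Rs J in
  exists (U : 'M[C]_r) (sigma : nat -> R) (V : 'M[C]_c) (lambda : 'I_r -> C),
    let v (l : 'I_r) := ((sigma l)%:C)^-1 *: (Rs^t* *m col l U) in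
    let w := \sum_(l < r | (l < k)%N)
               (lambda l / (sigma l)%:C ^+ 3) *: col l U in
    [/\ is_svd Cs U sigma V,
        forall l : 'I_r, (l < k)%N ->
          cabs (lambda l - inner (v l) (A^t* *m b))
            <= delta * (eps * sigma l ^+ 2 * fnorm b / Num.sqrt k%:R) &
        x = Rs^t* *m w].

(* Probability of the event E over the independent draws of the row indices I
   and then, given I, of the column indices J. *)
Definition sample_prob m n (A : 'M[C]_(m, n)) r c
    (E : {ffun 'I_r -> 'I_m} -> {ffun 'I_c -> 'I_n} -> Prop) : R :=
  \sum_(I : {ffun 'I_r -> 'I_m}) \sum_(J : {ffun 'I_c -> 'I_n} | `[< E I J >])
    (\prod_(s < r) row_prob A (I s))
    * (\prod_(t < c) col_prob (row_sketch A I) (J t)).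

End Algorithm.

(* Main.v *)
(* Since |A|_F^2 <= rank A <= k, length-square sampling already concentrates in
   Frobenius norm at the rate needed, and no matrix Chernoff bound is used.
   R^* R - A^* A is an average of r independent centred matrices X of Frobenius
   norm at most B = 2 |A|_F^2.  As e^y <= y + e^(y^2), for centred X,
     E exp(|s + X|^2 / t) <= exp((|s|^2 + B^2) / (t - 4 B^2)),
   and iterating over the samples gives a sub-Gaussian tail for the Frobenius
   norm of the sum.  C C^* - R R^* is treated in the same way, as the row sketch of R^*.

   On the event that both errors are small, let T and P be the pseudoinverse of
   C C^* and the projection on its range.  The solution computed with exact
   coefficients is R^* T^2 R A^* A y for y = A^+ b.  It lies in the row space
   of A, on which R is bounded below by a multiple of 1 / kappa, so it is enough to
   compare it with y after applying R; there R R^* T^2 R R^* is close to P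
   and P R y to R y.  The error of the coefficients is bounded by
   |b| <= |A y| / c0 <= |y| / c0. *)
Require Import Defs.
From mathcomp Require Import all_boot all_order all_algebra.
From mathcomp Require Import boolp classical_sets reals exp sequences.
From mathcomp Require Import complex.
From mathcomp Require Import ring lra.

Set Implicit Arguments.
Unset Strict Implicit.
Unset Printing Implicit Defensive.

Import Order.TTheory GRing.Theory Num.Theory.
Local Open Scope ring_scope.
Local Open Scope complex_scope.
Local Open Scope sesquilinear_scope.

(** * Frobenius inner product and norm inequalities *)

Section FrobeniusInnerProduct.
Context {R : realType}.
Local Notation C := R[i].

(** The real part of the Hilbert-Schmidt inner product: a symmetric real bilinear form, so that the
    estimates take place over [R]. *)
Definition rdot m n (A B : 'M[C]_(m, n)) : R := complex.Re (\tr (A^t* *m B)).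

Lemma adjmxM m n p (A : 'M[C]_(m, n)) (B : 'M[C]_(n, p)) :
  (A *m B)^t* = B^t* *m A^t*.
Proof. by rewrite trmx_mul map_mxM. Qed.

Lemma adjmxB m n (A B : 'M[C]_(m, n)) : (A - B)^t* = A^t* - B^t*.
Proof. by rewrite linearB /= map_mxB. Qed.

Lemma conjC_real (x : R) : Num.conj (x%:C) = x%:C.
Proof. exact: conjc_real. Qed.

Lemma adjmxZ m n (x : R) (A : 'M[C]_(m, n)) : (x%:C *: A)^t* = x%:C *: A^t*.
Proof. by apply/matrixP => i j; rewrite !mxE rmorphM /= conjC_real. Qed.

Lemma adjmx1 n : (1%:M : 'M[C]_n)^t* = 1%:M.
Proof. by rewrite trmx1 map_mx1. Qed.

Lemma Re_conj (z : C) : complex.Re (Num.conj z) = complex.Re z.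
Proof. by case: z. Qed.

Lemma ReD (x y : C) : complex.Re (x + y) = complex.Re x + complex.Re y.
Proof. by case: x => a b; case: y => c d. Qed.

Lemma Re_realM (x : R) (z : C) : complex.Re (x%:C * z) = x * complex.Re z.
Proof. by case: z => a b /=; rewrite mul0r subr0. Qed.

Lemma rdotC m n (A B : 'M[C]_(m, n)) : rdot A B = rdot B A.
Proof.
rewrite /rdot (_ : A^t* *m B = (B^t* *m A)^t*); last by rewrite adjmxM trmxCK.
by rewrite trace_map_mx mxtrace_tr Re_conj.
Qed.

Lemma rdotDr m n (A B D : 'M[C]_(m, n)) : rdot A (B + D) = rdot A B + rdot A D.
Proof. by rewrite /rdot mulmxDr linearD /= ReD. Qed.

Lemma rdotZr m n (x : R) (A B : 'M[C]_(m, n)) :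
  rdot A (x%:C *: B) = x * rdot A B.
Proof. by rewrite /rdot -scalemxAr linearZ /= Re_realM. Qed.

Lemma rdotDl m n (A B D : 'M[C]_(m, n)) : rdot (A + B) D = rdot A D + rdot B D.
Proof. by rewrite !(rdotC _ D) rdotDr. Qed.

Lemma rdotZl m n (x : R) (A B : 'M[C]_(m, n)) :
  rdot (x%:C *: A) B = x * rdot A B.
Proof. by rewrite !(rdotC _ B) rdotZr. Qed.

Lemma rdotNr m n (A B : 'M[C]_(m, n)) : rdot A (- B) = - rdot A B.
Proof. by rewrite -scaleN1r -(rmorphN1 (real_complex R)) rdotZr mulN1r. Qed.

Lemma rdot0r m n (A : 'M[C]_(m, n)) : rdot A 0 = 0.
Proof. by rewrite /rdot mulmx0 mxtrace0. Qed.

Lemma rdot_sumr m n (I : Type) (s : seq I) (P : pred I) (A : 'M[C]_(m, n)) F :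
  rdot A (\sum_(i <- s | P i) F i) = \sum_(i <- s | P i) rdot A (F i).
Proof. exact: (big_morph (rdot A) (rdotDr A) (rdot0r A)). Qed.

Lemma rdot_adjl m n p (M : 'M[C]_(m, n)) (A : 'M[C]_(n, p)) B :
  rdot (M *m A) B = rdot A (M^t* *m B).
Proof. by rewrite /rdot adjmxM mulmxA. Qed.

Lemma rdot_adjr m n p (M : 'M[C]_(m, n)) (A : 'M[C]_(n, p)) B :
  rdot B (M *m A) = rdot (M^t* *m B) A.
Proof. by rewrite rdotC rdot_adjl rdotC. Qed.

Lemma normc_sqr (z : C) :
  ComplexField.Normc.normc z ^+ 2 = complex.Re (Num.conj z * z).
Proof.
case: z => a b /=; rewrite sqr_sqrtr ?addr_ge0 ?sqr_ge0 //.
by rewrite mulNr opprK !expr2.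
Qed.

Lemma fnorm_ge0 m n (A : 'M[C]_(m, n)) : 0 <= fnorm A.
Proof. exact: sqrtr_ge0. Qed.

Lemma fnorm_sqrE m n (A : 'M[C]_(m, n)) :
  fnorm A ^+ 2 = \sum_i \sum_j ComplexField.Normc.normc (A i j) ^+ 2.
Proof.
rewrite /fnorm sqr_sqrtr //.
by apply: sumr_ge0 => i _; apply: sumr_ge0 => j _; exact: sqr_ge0.
Qed.

Lemma Re_sum (I : Type) (s : seq I) (P : pred I) (F : I -> C) :
  complex.Re (\sum_(i <- s | P i) F i) = \sum_(i <- s | P i) complex.Re (F i).
Proof. exact: (big_morph _ ReD erefl). Qed.

Lemma fnorm_sqr m n (A : 'M[C]_(m, n)) : fnorm A ^+ 2 = rdot A A.
Proof.
rewrite fnorm_sqrE /rdot /mxtrace Re_sum exchange_big /=.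
apply: eq_bigr => j _; rewrite mxE Re_sum; apply: eq_bigr => i _.
by rewrite !mxE normc_sqr.
Qed.

Lemma fnorm_eq m n p q (A : 'M[C]_(m, n)) (B : 'M[C]_(p, q)) :
  rdot A A = rdot B B -> fnorm A = fnorm B.
Proof.
rewrite -!fnorm_sqr => /eqP.
by rewrite eqrXn2 ?fnorm_ge0 // => /eqP.
Qed.

Lemma fnorm_adj m n (A : 'M[C]_(m, n)) : fnorm (A^t*) = fnorm A.
Proof.
apply: fnorm_eq; rewrite /rdot trmxCK mxtrace_mulC.
by rewrite -[in LHS](trmxCK A) trmxCK.
Qed.

Lemma fnorm0 m n : fnorm (0 : 'M[C]_(m, n)) = 0.
Proof. by apply/eqP; rewrite -sqrf_eq0 fnorm_sqr rdot0r. Qed.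

Lemma fnorm_eq0 m n (A : 'M[C]_(m, n)) : fnorm A = 0 -> A = 0.
Proof.
move=> A0; have : fnorm A ^+ 2 == 0 by rewrite A0 expr0n.
rewrite fnorm_sqrE psumr_eq0; last first.
  by move=> i _; apply: sumr_ge0 => j _; exact: sqr_ge0.
move=> /allP h; apply/matrixP => i j; rewrite mxE.
have := h i (mem_index_enum i); rewrite psumr_eq0 /=; last first.
  by move=> k _; exact: sqr_ge0.
move=> /allP /(_ j (mem_index_enum j)); rewrite sqrf_eq0 => /eqP.
exact: ComplexField.Normc.eq0_normc.
Qed.

Lemma fnormZ m n (x : R) (A : 'M[C]_(m, n)) :
  fnorm (x%:C *: A) = `|x| * fnorm A.
Proof.
apply/eqP; rewrite -(@eqrXn2 _ 2) ?mulr_ge0 ?fnorm_ge0 //.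
by rewrite exprMn real_normK ?num_real // !fnorm_sqr rdotZr rdotZl mulrA.
Qed.

Lemma fnormN m n (A : 'M[C]_(m, n)) : fnorm (- A) = fnorm A.
Proof. by apply: fnorm_eq; rewrite rdotNr rdotC rdotNr opprK. Qed.

Lemma fnorm_sqrD m n (A B : 'M[C]_(m, n)) :
  fnorm (A + B) ^+ 2 = fnorm A ^+ 2 + 2 * rdot A B + fnorm B ^+ 2.
Proof. rewrite !fnorm_sqr rdotDl !rdotDr (rdotC B A); ring. Qed.

(** Cauchy-Schwarz: with [a], [b] the two norms, the squared norm of [- b A + a B] expands to
    [2 a b (a b - rdot A B)]. *)
Lemma rdot_le m n (A B : 'M[C]_(m, n)) : rdot A B <= fnorm A * fnorm B.
Proof.
have [a0|a_neq0] := eqVneq (fnorm A) 0.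
  by rewrite (fnorm_eq0 a0) rdotC rdot0r fnorm0 mul0r.
have a_gt0 : 0 < fnorm A by rewrite lt_def a_neq0 fnorm_ge0.
set a := fnorm A in a_gt0 *; set b := fnorm B.
have : 0 <= fnorm ((- b)%:C *: A + a%:C *: B) ^+ 2 by exact: sqr_ge0.
rewrite fnorm_sqrD !fnormZ rdotZl rdotZr normrN.
rewrite !ger0_norm ?fnorm_ge0 // -/a -/b.
have b_ge0 : 0 <= b by exact: fnorm_ge0.
have [b0|b_neq0] := eqVneq b 0.
  by rewrite b0 mulr0 (fnorm_eq0 b0) rdot0r.
have b_gt0 : 0 < b by rewrite lt_def b_neq0.
have ab : 0 < 2 * (a * b) by rewrite !mulr_gt0.
rewrite (_ : _ + _ + _ = 2 * (a * b) * (a * b - rdot A B)); last by ring.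
by rewrite pmulr_rge0 // subr_ge0.
Qed.

Lemma rdot_abs_le m n (A B : 'M[C]_(m, n)) : `|rdot A B| <= fnorm A * fnorm B.
Proof.
by rewrite ler_norml rdot_le andbT lerNl -rdotNr -(fnormN B) rdot_le.
Qed.

Lemma fnormD m n (A B : 'M[C]_(m, n)) : fnorm (A + B) <= fnorm A + fnorm B.
Proof.
rewrite -(@ler_pXn2r _ 2) ?nnegrE ?addr_ge0 ?fnorm_ge0 // fnorm_sqrD.
have := rdot_le A B; nra.
Qed.

Lemma rdot_mulmxl m n p (A : 'M[C]_(m, n)) (M : 'M[C]_(n, p)) B :
  rdot (A *m M) B = rdot A (B *m M^t*).
Proof. by rewrite /rdot adjmxM -mulmxA mxtrace_mulC mulmxA. Qed.

Lemma adjmx_mul_self n (x : 'cV[C]_n) : x^t* *m x = ((fnorm x ^+ 2)%:C)%:M.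
Proof.
rewrite [LHS]mx11_scalar -trace_mx11 [\tr _]complexE fnorm_sqr.
rewrite (_ : complex.Im _ = 0) ?mulr0 ?addr0 //.
have ImD (u v : C) : complex.Im (u + v) = complex.Im u + complex.Im v.
  by case: u => ? ?; case: v => ? ?.
rewrite trace_mx11 mxE (big_morph _ ImD erefl) big1 // => i _.
by rewrite !mxE /=; case: (x i 0) => a b /=; rewrite mulNr [b * a]mulrC subrr.
Qed.

Lemma fnorm_mul_adj m n (z : 'cV[C]_m) (x : 'cV[C]_n) :
  fnorm (z *m x^t*) = fnorm z * fnorm x.
Proof.
apply/eqP; rewrite -(@eqrXn2 _ 2) ?mulr_ge0 ?fnorm_ge0 // exprMn.
rewrite fnorm_sqr rdot_mulmxl trmxCK -mulmxA adjmx_mul_self mul_mx_scalar.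
by rewrite rdotZr -fnorm_sqr mulrC.
Qed.

(* [|A x|^2] is the inner product of [A] with [A x x^*]. *)
Lemma fnorm_mulmx_col m n (A : 'M[C]_(m, n)) (x : 'cV[C]_n) :
  fnorm (A *m x) <= fnorm A * fnorm x.
Proof.
have [->|a_neq0] := eqVneq (fnorm (A *m x)) 0.
  by rewrite mulr_ge0 ?fnorm_ge0.
have a_gt0 : 0 < fnorm (A *m x) by rewrite lt_def a_neq0 fnorm_ge0.
rewrite -(ler_pM2r a_gt0) -expr2 fnorm_sqr.
apply: le_trans (_ : rdot A (A *m x *m x^t*) <= _).
  by rewrite {1}rdot_mulmxl.
by rewrite -mulrA [fnorm x * _]mulrC -fnorm_mul_adj rdot_le.
Qed.

Lemma fnorm_sqr_cols m n (A : 'M[C]_(m, n)) :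
  fnorm A ^+ 2 = \sum_j fnorm (col j A) ^+ 2.
Proof.
rewrite fnorm_sqrE exchange_big; apply: eq_bigr => j _.
by rewrite fnorm_sqrE; apply: eq_bigr => i _; rewrite big_ord1 mxE.
Qed.

Lemma fnorm_sqr_rows m n (A : 'M[C]_(m, n)) :
  fnorm A ^+ 2 = \sum_i fnorm (row i A) ^+ 2.
Proof.
rewrite fnorm_sqrE; apply: eq_bigr => i _.
by rewrite fnorm_sqrE big_ord1; apply: eq_bigr => j _; rewrite mxE.
Qed.

(** The squared Frobenius norm is a sum over columns, so an operator bound applies to each column of
    [B] separately. *)
Lemma fnorm_mul_cols m n p (c : R) (A : 'M[C]_(m, n)) (B : 'M[C]_(n, p)) :
    0 <= c -> (forall x : 'cV_n, fnorm (A *m x) <= c * fnorm x) ->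
  fnorm (A *m B) <= c * fnorm B.
Proof.
move=> c0 Ac; rewrite -(@ler_pXn2r _ 2) ?nnegrE ?mulr_ge0 ?fnorm_ge0 //.
rewrite exprMn !fnorm_sqr_cols mulr_sumr; apply: ler_sum => j _.
by rewrite -exprMn ler_pXn2r ?nnegrE ?mulr_ge0 ?fnorm_ge0 // !colE -mulmxA Ac.
Qed.

Lemma fnorm_mulmx m n p (A : 'M[C]_(m, n)) (B : 'M[C]_(n, p)) :
  fnorm (A *m B) <= fnorm A * fnorm B.
Proof. by apply: fnorm_mul_cols; [exact: fnorm_ge0 | exact: fnorm_mulmx_col]. Qed.

Lemma fnorm_opnorm m n (A : 'M[C]_(m, n)) (c : R) (x : 'cV[C]_n) :
  opnorm A <= c -> fnorm (A *m x) <= c * fnorm x.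
Proof.
move=> Ac; have [x0|x_neq0] := eqVneq (fnorm x) 0.
  by rewrite (fnorm_eq0 x0) mulmx0 !fnorm0 mulr0.
have x_gt0 : 0 < fnorm x by rewrite lt_def x_neq0 fnorm_ge0.
rewrite -ler_pdivrMr //; apply: le_trans Ac.
have xV : `|(fnorm x)^-1| = (fnorm x)^-1 by rewrite ger0_norm // invr_ge0 ltW.
(* The supremum is an upper bound only for a set bounded above; [fnorm A] bounds this one. The
   member used is [x] normalised. *)
apply: ub_le_sup.
  exists (fnorm A) => _ [y y1 <-].
  apply: le_trans (fnorm_mulmx_col A y) _.
  by rewrite ler_piMr ?fnorm_ge0.
exists ((fnorm x)^-1%:C *: x); first by rewrite /= fnormZ xV mulVf.
by rewrite -scalemxAr fnormZ xV mulrC.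
Qed.

(** For [z = A^* y], the square of [|z|] is the inner product of [y] and [A z], at most [|y| c |z|];
    one factor [|z|] cancels. *)
Lemma fnorm_adj_le m n (A : 'M[C]_(m, n)) (c : R) :
    0 <= c -> (forall x : 'cV_n, fnorm (A *m x) <= c * fnorm x) ->
  forall y : 'cV_m, fnorm (A^t* *m y) <= c * fnorm y.
Proof.
move=> c0 Ac y; set z := A^t* *m y.
have [->|z_neq0] := eqVneq (fnorm z) 0; first by rewrite mulr_ge0 ?fnorm_ge0.
have z_gt0 : 0 < fnorm z by rewrite lt_def z_neq0 fnorm_ge0.
rewrite -(ler_pM2r z_gt0) -expr2 fnorm_sqr {1}/z rdot_adjl trmxCK.
apply: le_trans (rdot_le _ _) _.
by rewrite -mulrA mulrCA ler_wpM2l ?fnorm_ge0.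
Qed.

Lemma fnorm_unitary m n p (U : 'M[C]_(m, n)) (z : 'M[C]_(n, p)) :
  U^t* *m U = 1%:M -> fnorm (U *m z) = fnorm z.
Proof. by move=> UU; apply: fnorm_eq; rewrite rdot_adjl mulmxA UU mul1mx. Qed.

End FrobeniusInnerProduct.

(** * Sub-Gaussian tail for sums of independent centred matrices *)

Section Concentration.
Context {R : realType}.
Local Notation C := R[i].

Lemma expR_le_addr_sqr (x : R) : expR x <= x + expR (x ^+ 2).
Proof.
have e1 (y : R) := expR_ge1Dx y.
have [x1|x1] := leP 1 x.
  apply: le_trans (_ : expR (x ^+ 2) <= _); last by rewrite lerDr; lra.
  by rewrite ler_expR; nra.
(* For [x <= 0], [expR x <= 1 / (1 - x)], and [(1 + x + x ^ 2) (1 - x) = 1 - x ^ 3] is at least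
   1. *)
have [x0|x0] := leP x 0.
  apply: (le_trans (y := (1 - x)^-1)).
    rewrite -[X in expR X]opprK expRN lef_pV2 ?posrE ?expR_gt0 //; lra.
  apply: (le_trans (y := x + (1 + x ^+ 2))); last by rewrite lerD2l e1.
  by rewrite -[_^-1]mul1r ler_pdivrMr; nra.
(* Both exponentials are bounded by [1 / (1 - y)], and
   [(1 - x + x ^ 2) (1 + x) = 1 + x ^ 3]. *)
have u_gt0 : 0 < 1 - (x - x ^+ 2) by nra.
have v_gt0 : 0 < 1 - x ^+ 2 by nra.
have exp_le_inv (y : R) : 0 < 1 - y -> expR y <= (1 - y)^-1.
  move=> y_lt1; rewrite -[X in expR X]opprK expRN.
  by rewrite lef_pV2 ?posrE ?expR_gt0.
have eu := exp_le_inv _ u_gt0; have ev := exp_le_inv _ v_gt0.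
(* The difference of the exponentials factors as [expR (x ^ 2)] times [expR (x - x ^ 2) - 1], and
   each factor is bounded separately. *)
rewrite -lerBlDr; apply: (le_trans (y := expR (x ^+ 2) * (expR (x - x ^+ 2) - 1))).
  by rewrite mulrBr mulr1 [_ * expR (x - _)]mulrC -expRD subrK.
apply: (le_trans (y := (1 - x ^+ 2)^-1 * ((1 - (x - x ^+ 2))^-1 - 1))).
  have := expR_ge0 (x ^+ 2); have := expR_ge0 (x - x ^+ 2).
  have u1 : 1 <= (1 - (x - x ^+ 2))^-1 by rewrite invf_ge1 //; nra.
  move=> _ h; apply: (le_trans (y := expR (x ^+ 2) * ((1 - (x - x ^+ 2))^-1 - 1))).
    by rewrite ler_wpM2l // lerD2r.
  by rewrite ler_wpM2r // subr_ge0.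
rewrite (_ : _ - 1 = (x - x ^+ 2) / (1 - (x - x ^+ 2))); last first.
  by field; rewrite gt_eqF.
rewrite mulrC ler_pdivrMr // ler_pdivrMr //.
have x3 : 0 <= x ^+ 3 by rewrite exprn_ge0 // ltW.
have x4 : 0 <= x * x ^+ 3 * (1 - x) by rewrite !mulr_ge0 //; lra.
rewrite -subr_ge0; apply: le_trans x4 _.
by rewrite -subr_ge0 [leRHS](_ : _ = 0) //; ring.
Qed.

Definition ffun_cons (T : finType) r (x : T) (I : {ffun 'I_r -> T})
    : {ffun 'I_r.+1 -> T} :=
  [ffun s => if unlift ord0 s is Some j then I j else x].

Lemma ffun_cons0 (T : finType) r x (I : {ffun 'I_r -> T}) :
  ffun_cons x I ord0 = x.
Proof. by rewrite ffunE unlift_none. Qed.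

Lemma ffun_consS (T : finType) r x (I : {ffun 'I_r -> T}) j :
  ffun_cons x I (lift ord0 j) = I j.
Proof. by rewrite ffunE liftK. Qed.

(** Separating the first draw from the others prepares the induction on the number of samples. *)
Lemma sum_ffunS (V : nmodType) (T : finType) r (F : {ffun 'I_r.+1 -> T} -> V) :
  \sum_I F I = \sum_x \sum_(I : {ffun 'I_r -> T}) F (ffun_cons x I).
Proof.
rewrite pair_bigA (reindex (fun xI => ffun_cons xI.1 xI.2)) //=.
exists (fun I : {ffun _} => (I ord0, [ffun j => I (lift ord0 j)])) => [[x I] _|I _] /=.
  by rewrite ffun_cons0; congr pair; apply/ffunP => j; rewrite ffunE ffun_consS.
by apply/ffunP => s; rewrite ffunE; case: unliftP => [j|] ->; rewrite ?ffunE.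
Qed.

Lemma sum_prod_ffun (T : finType) r (p : T -> R) : \sum_x p x = 1 ->
  \sum_(I : {ffun 'I_r -> T}) \prod_s p (I s) = 1.
Proof. by move=> p1; rewrite -(bigA_distr_bigA (fun _ x => p x)) p1 big1. Qed.

Section VectorHoeffding.
Variables (T : finType) (p : T -> R) (m n : nat) (X : T -> 'M[C]_(m, n)) (B : R).
Hypothesis p_ge0 : forall x, 0 <= p x.
Hypothesis p_sum1 : \sum_x p x = 1.
Hypothesis X_centered : \sum_x (p x)%:C *: X x = 0.
Hypothesis X_bounded : forall x, fnorm (X x) <= B.

(* [expR_le_addr_sqr] isolates the term linear in [X x], which has mean zero. *)
Lemma exp_sqr_fnorm_step (tau : R) (S : 'M[C]_(m, n)) : 4 * B ^+ 2 < tau ->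
  \sum_x p x * expR (fnorm (S + X x) ^+ 2 / tau)
    <= expR ((fnorm S ^+ 2 + B ^+ 2) / (tau - 4 * B ^+ 2)).
Proof.
move=> Btau; set N := fnorm S ^+ 2.
have N_ge0 : 0 <= N by exact: sqr_ge0.
have B2_ge0 : 0 <= B ^+ 2 by exact: sqr_ge0.
have tau_gt0 : 0 < tau by lra.
(* [e0] bounds the part of the exponential free of [rdot S (X x)]; by Cauchy-Schwarz, [e1] bounds
   the exponential of the square of the linear part. *)
set e0 := expR ((N + B ^+ 2) / tau).
set e1 := expR (4 * N * B ^+ 2 / tau ^+ 2).
have step x : p x * expR (fnorm (S + X x) ^+ 2 / tau)
    <= e0 * (2 / tau) * (p x * rdot S (X x)) + p x * (e0 * e1).
  have B_ge0 : 0 <= B by exact: le_trans (fnorm_ge0 _) (X_bounded x).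
  rewrite [e0 * _ * _](_ : _ = p x * (e0 * (2 * rdot S (X x) / tau))); last first.
    by ring.
  rewrite -mulrDr -mulrDr ler_wpM2l //.
  set y := 2 * rdot S (X x) / tau.
  apply: (le_trans (y := expR ((N + B ^+ 2) / tau + y))).
    rewrite ler_expR -mulrDl ler_pM2r ?invr_gt0 // fnorm_sqrD -/N.
    by rewrite [leRHS]addrAC lerD2l ler_pXn2r ?nnegrE ?fnorm_ge0.
  rewrite expRD ler_wpM2l ?expR_ge0 //.
  apply: le_trans (expR_le_addr_sqr _) _; rewrite lerD2l ler_expR.
  rewrite /y expr_div_n ler_pM2r ?invr_gt0 ?exprn_gt0 // exprMn -mulrA.
  rewrite (_ : 2 ^+ 2 = 4); last by ring.
  rewrite ler_pM2l // -exprMn -real_normK ?num_real //.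
  rewrite ler_pXn2r ?nnegrE ?mulr_ge0 ?fnorm_ge0 //.
  by apply: le_trans (rdot_abs_le _ _) _; rewrite ler_wpM2l ?fnorm_ge0.
apply: le_trans (ler_sum _ (fun x _ => step x)) _.
rewrite big_split /= -mulr_sumr -mulr_suml p_sum1 mul1r.
rewrite (_ : \sum_i _ = 0); last first.
  under eq_bigr do rewrite -rdotZr.
  by rewrite -rdot_sumr X_centered rdot0r.
rewrite mulr0 add0r -expRD ler_expR.
have g_gt0 : 0 < tau - 4 * B ^+ 2 by lra.
rewrite ler_pdivlMr //.
rewrite (_ : (N + B ^+ 2) / tau + _
             = (tau * (N + B ^+ 2) + 4 * N * B ^+ 2) / tau ^+ 2); last first.
  by field; rewrite gt_eqF.
rewrite mulrAC ler_pdivrMr ?exprn_gt0 //.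
rewrite -subr_ge0 (_ : _ - _ = (4 * B ^+ 2) * (tau * B ^+ 2 + 4 * N * B ^+ 2)); last by ring.
have tB : 0 <= tau * B ^+ 2 by rewrite mulr_ge0 // ltW.
have NB : 0 <= N * B ^+ 2 by rewrite mulr_ge0.
by apply: mulr_ge0; lra.
Qed.

(** Induction on [r] for all [S]: summing over the last [r] draws lowers the denominator from [tau]
    to [tau'], and the first draw then lowers it by a further [4 B ^ 2]. *)
Lemma exp_sqr_fnorm_sum r (tau : R) (S : 'M[C]_(m, n)) : 4 * B ^+ 2 * r%:R < tau ->
  \sum_(I : {ffun 'I_r -> T})
     (\prod_s p (I s)) * expR (fnorm (S + \sum_s X (I s)) ^+ 2 / tau)
    <= expR ((fnorm S ^+ 2 + r%:R * B ^+ 2) / (tau - 4 * B ^+ 2 * r%:R)).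
Proof.
elim: r S => [|r IHr] S.
  rewrite mulr0 subr0 mul0r addr0 => _.
  under eq_bigr do rewrite !big_ord0 mul1r addr0.
  by rewrite sumr_const card_ffun card_ord expn0.
have B2_ge0 : 0 <= B ^+ 2 by exact: sqr_ge0.
rewrite -natr1 => rtau; rewrite sum_ffunS.
set tau' := tau - 4 * B ^+ 2 * r%:R.
have tau'_gt : 4 * B ^+ 2 < tau' by rewrite /tau'; lra.
have tau'_gt0 : 0 < tau' by lra.
apply: (le_trans (y := \sum_x p x * expR (fnorm (S + X x) ^+ 2 / tau')
                         * expR (r%:R * B ^+ 2 / tau'))).
  apply: ler_sum => x _; rewrite -mulrA -expRD -mulrDl.
  apply: le_trans (ler_wpM2l (p_ge0 x) (IHr (S + X x) _)); last by lra.
  rewrite mulr_sumr le_eqVlt; apply/orP; left; apply/eqP.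
  apply: eq_bigr => I _; rewrite !big_ord_recl !ffun_cons0 mulrA addrA.
  have tailE (V : Type) (op : V -> V -> V) (idx : V) (f : T -> V) :
      \big[op/idx]_(s < r) f (ffun_cons x I (lift ord0 s))
      = \big[op/idx]_(s < r) f (I s).
    by apply: eq_bigr => s _; rewrite ffun_consS.
  by rewrite !tailE.
rewrite -mulr_suml; apply: le_trans (ler_wpM2r (expR_ge0 _) (exp_sqr_fnorm_step _ tau'_gt)) _.
rewrite -expRD ler_expR (_ : tau - _ = tau' - 4 * B ^+ 2); last by rewrite /tau'; ring.
rewrite (_ : _ + r.+1%:R * _ = fnorm S ^+ 2 + B ^+ 2 + r%:R * B ^+ 2); last first.
  by rewrite -natr1; ring.
have rB2_ge0 : 0 <= r%:R * B ^+ 2 by rewrite mulr_ge0.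
rewrite [leRHS]mulrDl lerD2l; apply: ler_wpM2l => //.
rewrite lef_pV2 ?posrE; lra.
Qed.

(** Markov's inequality for the exponential moment with [S = 0]. For [tau = 8 r B ^ 2] the moment
    bound has denominator [4 r B ^ 2], which yields the factor [expR (1 / 4)]. *)
Lemma fnorm_sum_tail r (theta : R) : (0 < r)%N -> 0 < B -> 0 <= theta ->
  \sum_(I : {ffun 'I_r -> T} | ~~ (fnorm (\sum_s X (I s)) <= theta))
     \prod_s p (I s)
    <= expR (4^-1 - theta ^+ 2 / (8 * r%:R * B ^+ 2)).
Proof.
move=> r_gt0 B_gt0 theta_ge0; set tau := 8 * r%:R * B ^+ 2.
have rR : 0 < r%:R :> R by rewrite ltr0n.
have B2 : 0 < B ^+ 2 by rewrite exprn_gt0.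
have rB : 0 < r%:R * B ^+ 2 by rewrite mulr_gt0.
have tau_gt0 : 0 < tau by rewrite /tau -mulrA; lra.
have prod_ge0 (I : {ffun 'I_r -> T}) : 0 <= \prod_s p (I s).
  by apply: prodr_ge0 => s _.
rewrite expRD expRN ler_pdivlMr ?expR_gt0 // mulr_suml.
apply: (le_trans (y := \sum_(I : {ffun 'I_r -> T})
     (\prod_s p (I s)) * expR (fnorm (0 + \sum_s X (I s)) ^+ 2 / tau))).
  rewrite [leRHS](bigID (fun I : {ffun 'I_r -> T} => fnorm (\sum_s X (I s)) <= theta)) /=.
  rewrite -[leLHS]add0r; apply: lerD.
    by apply: sumr_ge0 => I _; rewrite mulr_ge0 ?expR_ge0.
  apply: ler_sum => I; rewrite -ltNge add0r => lt_theta.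
  rewrite ler_wpM2l // ler_expR ler_pM2r ?invr_gt0 //.
  by rewrite ler_pXn2r ?nnegrE ?fnorm_ge0 // ltW.
apply: le_trans (exp_sqr_fnorm_sum _ _) _; first by rewrite /tau; lra.
rewrite ler_expR fnorm0 expr0n add0r /tau.
rewrite ler_pdivrMr; last by lra.
lra.
Qed.

End VectorHoeffding.
End Concentration.

(** * Length-square sampling of rows and columns *)

Section Sampling.
Context {R : realType}.
Local Notation C := R[i].

Lemma gram_sum_rows m n (A : 'M[C]_(m, n)) :
  A^t* *m A = \sum_i (row i A)^t* *m row i A.
Proof.
apply/matrixP => j k; rewrite summxE mxE; apply: eq_bigr => i _.
by rewrite [RHS]mxE big_ord1 !mxE.
Qed.

Lemma fnorm_row_gram m n (A : 'M[C]_(m, n)) i :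
  fnorm ((row i A)^t* *m row i A) = fnorm (row i A) ^+ 2.
Proof. by rewrite -{2}(trmxCK (row i A)) fnorm_mul_adj fnorm_adj expr2. Qed.

Lemma row_prob_ge0 m n (A : 'M[C]_(m, n)) i : 0 <= row_prob A i.
Proof. by rewrite /row_prob divr_ge0 ?sqr_ge0. Qed.

Lemma sum_row_prob m n (A : 'M[C]_(m, n)) :
  0 < fnorm A -> \sum_i row_prob A i = 1.
Proof.
by move=> A0; rewrite -mulr_suml -fnorm_sqr_rows divff // gt_eqF ?exprn_gt0.
Qed.

(** The one-draw estimator of [A^* A], unbiased under [row_prob]. It is 0 on a zero row. *)
Definition scaled_row_gram m n (A : 'M[C]_(m, n)) i : 'M[C]_n :=
  (fnorm A ^+ 2 / fnorm (row i A) ^+ 2)%:C *: ((row i A)^t* *m row i A).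

Lemma row_sketch_gram m n (A : 'M[C]_(m, n)) r (I : {ffun 'I_r -> 'I_m}) :
    (0 < r)%N ->
  (row_sketch A I)^t* *m row_sketch A I - A^t* *m A
  = \sum_s (r%:R^-1)%:C *: (scaled_row_gram A (I s) - A^t* *m A).
Proof.
move=> r0; have rR : r%:R != 0 :> R by rewrite pnatr_eq0 -lt0n.
rewrite -scaler_sumr sumrB sumr_const card_ord scalerBr.
rewrite -scalerMnr scalerMnl -rmorphMn /= -[_^-1 *+ r]mulr_natr mulVf // scale1r; congr (_ - _).
rewrite gram_sum_rows scaler_sumr; apply: eq_bigr => s _.
have -> : row s (row_sketch A I)
    = (fnorm A / Num.sqrt r%:R / fnorm (row (I s) A))%:C *: row (I s) A.
  by apply/rowP => j; rewrite !mxE.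
rewrite adjmxZ -scalemxAl -scalemxAr !scalerA -!rmorphM; congr (_%:C *: _).
by rewrite -expr2 !expr_div_n (sqr_sqrtr (ler0n R r)) mulrA [_^-1 * _]mulrC.
Qed.

(** [fnorm_sum_tail] with [B = 2 |A|^2 / r]: each summand is [1 / r] times a difference of two
    matrices of norm at most [|A|^2] (Frobenius norms throughout). *)
Lemma row_sketch_tail m n (A : 'M[C]_(m, n)) r (theta : R) :
    0 < fnorm A -> (0 < r)%N -> 0 <= theta ->
  \sum_(I : {ffun 'I_r -> 'I_m} | ~~ (fnorm ((row_sketch A I)^t* *m row_sketch A I
                                             - A^t* *m A) <= theta))
     \prod_s row_prob A (I s)
    <= expR (4^-1 - theta ^+ 2 * r%:R / (32 * fnorm A ^+ 4)).
Proof.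
move=> A0 r0 theta0; have rR : 0 < r%:R :> R by rewrite ltr0n.
have AA : fnorm (A^t* *m A) <= fnorm A ^+ 2.
  by apply: le_trans (fnorm_mulmx _ _) _; rewrite fnorm_adj expr2.
under eq_bigl do rewrite row_sketch_gram //.
have B0 : 0 < 2 * fnorm A ^+ 2 / r%:R by rewrite divr_gt0 ?mulr_gt0 ?exprn_gt0.
have := @fnorm_sum_tail _ _ (row_prob A) _ _
  (fun i => (r%:R^-1)%:C *: (scaled_row_gram A i - A^t* *m A))
  (2 * fnorm A ^+ 2 / r%:R) (row_prob_ge0 A) (sum_row_prob A0) _ _ r theta r0 B0 theta0.
rewrite (_ : theta ^+ 2 / _ = theta ^+ 2 * r%:R / (32 * fnorm A ^+ 4)); last first.
  by field; rewrite !gt_eqF.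
apply.
  under eq_bigr do rewrite scalerA mulrC -scalerA scalerBr.
  rewrite -scaler_sumr sumrB -scaler_suml -rmorph_sum sum_row_prob //= scale1r.
  rewrite gram_sum_rows -sumrB big1 ?scaler0 // => i _.
  rewrite /scaled_row_gram scalerA -rmorphM /row_prob.
  (* On a zero row the weight is 0 and so is the Gram term, so the two sides still agree. *)
  have [row0|row_neq0] := eqVneq (fnorm (row i A)) 0.
    by rewrite (fnorm_eq0 row0) mulmx0 scaler0 subrr.
  by rewrite mulrA mulfVK ?sqrf_eq0 ?(gt_eqF A0) // divff ?sqrf_eq0 // scale1r subrr.
move=> i; rewrite fnormZ ger0_norm ?invr_ge0 ?ler0n // [leLHS]mulrC ler_pM2r ?invr_gt0 //.
apply: le_trans (fnormD _ _) _; rewrite fnormN mulr_natl mulr2n lerD //.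
rewrite fnormZ fnorm_row_gram ger0_norm ?divr_ge0 ?sqr_ge0 //.
have [->|row_neq0] := eqVneq (fnorm (row i A)) 0.
  by rewrite expr0n mulr0 sqr_ge0.
by rewrite divfK // sqrf_eq0.
Qed.

(** The scaling gives all sampled rows the same length; this identifies the law of the columns in
    [col_prob_adj]. *)
Lemma fnorm_row_sketch_row m n (A : 'M[C]_(m, n)) r (I : {ffun 'I_r -> 'I_m}) s :
    (forall s, fnorm (row (I s) A) != 0) ->
  fnorm (row s (row_sketch A I)) ^+ 2 = fnorm A ^+ 2 / r%:R.
Proof.
move=> I0.
have -> : row s (row_sketch A I)
    = (fnorm A / Num.sqrt r%:R / fnorm (row (I s) A))%:C *: row (I s) A.
  by apply/rowP => j; rewrite !mxE.
rewrite fnormZ ger0_norm ?divr_ge0 ?fnorm_ge0 ?sqrtr_ge0 //.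
by rewrite divfK ?I0 // expr_div_n (sqr_sqrtr (ler0n R r)).
Qed.

Lemma fnorm_row_sketch m n (A : 'M[C]_(m, n)) r (I : {ffun 'I_r -> 'I_m}) :
    (0 < r)%N -> (forall s, fnorm (row (I s) A) != 0) ->
  fnorm (row_sketch A I) = fnorm A.
Proof.
move=> r0 I0; apply/eqP; rewrite -(@eqrXn2 _ 2) ?fnorm_ge0 //.
rewrite fnorm_sqr_rows; under eq_bigr do rewrite fnorm_row_sketch_row //.
by rewrite sumr_const card_ord -[X in X == _]mulr_natr divfK // pnatr_eq0 -lt0n.
Qed.

Lemma row_adj r n (M : 'M[C]_(r, n)) j : row j (M^t*) = (col j M)^t*.
Proof. by apply/rowP => s; rewrite !mxE. Qed.

(** Reduces column sampling to row sampling of the adjoint, so that [row_sketch_tail] serves both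
    steps of the algorithm. *)
Lemma col_sketch_adj r n (M : 'M[C]_(r, n)) c (J : {ffun 'I_c -> 'I_n}) :
  col_sketch (fnorm M) M J = (row_sketch (M^t*) J)^t*.
Proof.
apply/matrixP => s t; rewrite !mxE row_adj !fnorm_adj [RHS]rmorphM /= conjC_real.
by congr (_ * _); exact/esym/conjcK.
Qed.

(** With rows of equal length the uniform weight [1 / r] cancels against the row norm, and the
    mixture becomes length-square sampling of the columns. *)
Lemma col_prob_adj r n (M : 'M[C]_(r, n)) j :
    (0 < r)%N -> (forall s, fnorm (row s M) ^+ 2 = fnorm M ^+ 2 / r%:R) ->
  col_prob M j = row_prob (M^t*) j.
Proof.
move=> r0 Mrow; have rR : r%:R != 0 :> R by rewrite pnatr_eq0 -lt0n.
rewrite /col_prob /row_prob row_adj !fnorm_adj fnorm_sqrE mulr_suml.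
apply: eq_bigr => s _; rewrite big_ord1 Mrow mxE.
by rewrite invf_div mulrCA [r%:R^-1 * _]mulrA mulVf // mul1r.
Qed.

(** Each step succeeds with probability at least [1 - eta / 2], the second conditionally on the
    first, and [(1 - eta / 2) ^ 2 >= 1 - eta]. *)
Lemma sample_prob_ge m n (A : 'M[C]_(m, n)) r c
    (E : {ffun 'I_r -> 'I_m} -> {ffun 'I_c -> 'I_n} -> Prop)
    (good1 : pred {ffun 'I_r -> 'I_m})
    (good2 : {ffun 'I_r -> 'I_m} -> pred {ffun 'I_c -> 'I_n}) (eta : R) :
    0 < fnorm A -> (0 < r)%N -> 0 < eta < 1 ->
    (forall (I : {ffun 'I_r -> 'I_m}) (J : {ffun 'I_c -> 'I_n}),
       (forall s, fnorm (row (I s) A) != 0) -> good1 I -> good2 I J -> E I J) ->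
    \sum_(I | ~~ good1 I) \prod_s row_prob A (I s) <= eta / 2 ->
    (forall I : {ffun 'I_r -> 'I_m}, (forall s, fnorm (row (I s) A) != 0) ->
       \sum_(J | ~~ good2 I J) \prod_t row_prob ((row_sketch A I)^t*) (J t) <= eta / 2) ->
  1 - eta <= sample_prob A E.
Proof.
move=> A0 r0 /andP[eta0 eta1] goodE bad1 bad2.
set p := fun I : {ffun 'I_r -> 'I_m} => \prod_s row_prob A (I s).
have p_ge0 I : 0 <= p I by apply: prodr_ge0 => s _; exact: row_prob_ge0.
have q_ge0 I j : 0 <= col_prob (row_sketch A I) j.
  apply: sumr_ge0 => s _.
  by rewrite mulr_ge0 ?invr_ge0 ?ler0n // divr_ge0 ?sqr_ge0.
have p_good : 1 - eta / 2 <= \sum_(I | good1 I) p I.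
  rewrite lerBlDr -[leLHS](sum_prod_ffun r (sum_row_prob A0)) (bigID good1) /=.
  by rewrite lerD2l; exact: bad1.
apply: (le_trans (y := \sum_(I | good1 I) p I * (1 - eta / 2))).
  rewrite -mulr_suml; apply: le_trans (ler_wpM2r _ p_good); nra.
rewrite /sample_prob [leRHS](bigID good1) /= -[leLHS]addr0; apply: lerD; last first.
  by apply: sumr_ge0 => I _; apply: sumr_ge0 => J _;
     apply: mulr_ge0; [exact: p_ge0 | by apply: prodr_ge0 => t _].
apply: ler_sum => I gI; rewrite -mulr_sumr.
(* Draws of weight 0 contribute nothing; positive weight forces every sampled row to be nonzero. *)
have [p0|p_neq0] := eqVneq (p I) 0; first by rewrite -/(p I) p0 !mul0r.
rewrite ler_wpM2l //.
have I0 s : fnorm (row (I s) A) != 0.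
  apply: contraNneq p_neq0 => row0; apply/prodf_eq0; exists s => //.
  by rewrite /row_prob row0 expr0n mul0r.
have nM := fnorm_row_sketch r0 I0.
have M0 : 0 < fnorm ((row_sketch A I)^t*) by rewrite fnorm_adj nM.
have qE (J : {ffun 'I_c -> 'I_n}) : \prod_t col_prob (row_sketch A I) (J t)
    = \prod_t row_prob ((row_sketch A I)^t*) (J t).
  apply: eq_bigr => t _; apply: col_prob_adj => // s.
  by rewrite fnorm_row_sketch_row // nM.
rewrite lerBlDr -[leLHS](sum_prod_ffun c (sum_row_prob M0)).
rewrite (bigID (good2 I)) /=; apply: lerD; last exact: bad2.
under [leRHS]eq_bigr do rewrite qE.
rewrite [leRHS](bigID (good2 I)) /= -[leLHS]addr0; apply: lerD.
  rewrite le_eqVlt; apply/orP; left; apply/eqP; apply: eq_bigl => J.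
  have [gJ|] := boolP (good2 I J); last by rewrite andbF.
  by rewrite andbT; apply/esym/asboolP/goodE.
by apply: sumr_ge0 => J _; rewrite prodr_ge0 // => t _; exact: row_prob_ge0.
Qed.

End Sampling.

(** * Functional calculus in a unitary eigenbasis *)

Section SpectralCalculus.
Context {R : realType}.
Local Notation C := R[i].

(** The Hermitian matrix with eigenvalue [d l] on column [l] of [U]. Functions of one spectrum then
    multiply and subtract pointwise. *)
Definition udiag r (U : 'M[C]_r) (d : 'I_r -> R) : 'M[C]_r :=
  U *m diag_mx (\row_l (d l)%:C) *m U^t*.

Variables (r : nat) (U : 'M[C]_r).
Hypothesis U_unitary : U \is unitarymx.

Let UUt : U *m U^t* = 1%:M. Proof. exact/unitarymxP. Qed.
Let UtU : U^t* *m U = 1%:M. Proof. exact: mulmx1C. Qed.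

Lemma udiagM d e : udiag U d *m udiag U e = udiag U (fun l => d l * e l).
Proof.
rewrite /udiag !mulmxA -[_ *m U^t* *m U]mulmxA UtU mulmx1 -[_ *m diag_mx _ *m diag_mx _]mulmxA.
rewrite mulmx_diag; congr (_ *m diag_mx _ *m _).
by apply/rowP => l; rewrite !mxE rmorphM.
Qed.

Lemma eq_udiag d e : d =1 e -> udiag U d = udiag U e.
Proof.
by move=> de; congr (_ *m diag_mx _ *m _); apply/rowP => l; rewrite !mxE de.
Qed.

Lemma udiag1 : udiag U (fun=> 1) = 1%:M.
Proof.
rewrite /udiag (_ : diag_mx _ = 1%:M) ?mulmx1 //.
by apply/matrixP => i j; rewrite !mxE.
Qed.

Lemma udiagB d e : udiag U d - udiag U e = udiag U (fun l => d l - e l).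
Proof.
rewrite /udiag -mulmxBl -mulmxBr; congr (_ *m _ *m _).
by apply/matrixP => i j; rewrite !mxE -mulrnBl rmorphB.
Qed.

Lemma udiag_adj d : (udiag U d)^t* = udiag U d.
Proof.
rewrite /udiag !adjmxM trmxCK mulmxA; congr (_ *m _ *m _).
rewrite tr_diag_mx map_diag_mx; congr diag_mx; apply/rowP => l; rewrite !mxE.
exact: conjC_real.
Qed.

Lemma fnorm_unitary_mul p (z : 'M[C]_(r, p)) : fnorm (U *m z) = fnorm z.
Proof. exact: fnorm_unitary. Qed.

Lemma fnorm_unitary_adj_mul p (z : 'M[C]_(r, p)) : fnorm (U^t* *m z) = fnorm z.
Proof. by apply: fnorm_unitary; rewrite trmxCK. Qed.

Lemma udiag_le d (c : R) (z : 'cV[C]_r) : (forall l, `|d l| <= c) ->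
  0 <= c -> fnorm (udiag U d *m z) <= c * fnorm z.
Proof.
move=> dc c0; rewrite /udiag -!mulmxA fnorm_unitary_mul -(fnorm_unitary_adj_mul z).
rewrite -(@ler_pXn2r _ 2) ?nnegrE ?mulr_ge0 ?fnorm_ge0 //.
rewrite exprMn !fnorm_sqrE mulr_sumr; apply: ler_sum => l _.
rewrite !big_ord1 mul_diag_mx !mxE ComplexField.Normc.normcM exprMn.
rewrite ler_wpM2r ?sqr_ge0 // normc_sqr conjC_real -rmorphM /=.
by rewrite -expr2 -real_normK ?num_real // ler_pXn2r ?nnegrE.
Qed.

Lemma udiag_col d l : udiag U d *m col l U = (d l)%:C *: col l U.
Proof.
rewrite /udiag colE !mulmxA -[_ *m U^t* *m U]mulmxA UtU mulmx1 -mulmxA mul_diag_mx scalemxAr.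
congr (_ *m _); apply/matrixP => i j; rewrite !mxE.
by have [->|] := eqVneq i l; rewrite ?andbF ?mulr0.
Qed.

End SpectralCalculus.

(** * Gram matrix and rank in terms of singular values *)

Section SingularValues.
Context {R : realType}.
Local Notation C := R[i].
Variables (r c : nat) (M : 'M[C]_(r, c)) (U : 'M[C]_r) (sigma : nat -> R) (V : 'M[C]_c).
Hypothesis svd : is_svd M U sigma V.

Lemma svd_gram : M *m M^t* = udiag U (fun l => sigma l ^+ 2).
Proof.
case: svd => Uu Vu _ [_ sigma0] ->; set S := \matrix_(_, _) _.
have VtV : V^t* *m V = 1%:M by apply: mulmx1C; exact/unitarymxP.
rewrite !adjmxM trmxCK !mulmxA -[_ *m V^t* *m V]mulmxA VtV mulmx1 -[_ *m S *m _]mulmxA.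
congr (_ *m _ *m _); apply/matrixP => i j; rewrite !mxE.
(* A row [i >= c] of the rectangular diagonal is zero, in accordance with the extension of [sigma]
   by 0. *)
have [ic|ci] := ltnP i c; last first.
  rewrite (sigma0 i) ?geq_min ?ci ?orbT // expr0n mul0rn big1 // => t _.
  by rewrite !mxE gtn_eqF ?mul0r // (leq_trans (ltn_ord t)).
rewrite (bigD1 (Ordinal ic)) //= big1 ?addr0; last first.
  move=> t ti; rewrite !mxE ifN ?mul0r //.
  by apply: contra ti => /eqP it; apply/eqP/val_inj.
rewrite !mxE eqxx /=; have [<-|ij] := eqVneq i j.
  by rewrite eqxx conjC_real -rmorphM expr2 mulr1n.
by rewrite ifN ?rmorph0 ?mulr0 // eq_sym.
Qed.

(** If [sigma l] were nonzero, so would be all earlier singular values; rescaling the diagonal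
    factor by their inverses would give a partial identity of rank [l + 1 > k], although
    multiplication cannot raise the rank of [M]. *)
Lemma svd_rank k l : (\rank M <= k)%N -> (k <= l)%N -> sigma l = 0.
Proof.
case: svd => Uu Vu sigma_anti [sigma_ge0 sigma0] ME rk kl.
apply/eqP; apply: contraTT rk => sl; rewrite -ltnNge.
have lt_l_rc : (l < minn r c)%N.
  by rewrite ltnNge; apply: contra sl => /sigma0 ->.
have [lr lc] : (l < r)%N /\ (l < c)%N by apply/andP; rewrite -leq_min.
have sigma_neq0 i : (i <= l)%N -> sigma i != 0.
  move=> il; rewrite gt_eqF // (lt_le_trans _ (sigma_anti _ _ il)) //.
  by rewrite lt_def sl sigma_ge0.
set S := \matrix_(_, _) _ in ME.
have SE : S = U^t* *m M *m V.
  have UtU : U^t* *m U = 1%:M by apply: mulmx1C; exact/unitarymxP.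
  have VtV : V^t* *m V = 1%:M by apply: mulmx1C; exact/unitarymxP.
  by rewrite ME !mulmxA UtU mul1mx -mulmxA VtV mulmx1.
pose d : 'rV[C]_r := \row_i (if (i <= l)%N then (sigma i)^-1 else 0)%:C.
have pidE : pid_mx l.+1 = diag_mx d *m S.
  apply/matrixP => i j; rewrite mul_diag_mx !mxE ltnS.
  have [_|] := eqVneq (i : nat) j; last by rewrite mulr0.
  by case: ifP => il /=; rewrite ?mul0r // -rmorphM mulVf ?sigma_neq0.
apply: (leq_trans (n := \rank (pid_mx l.+1 : 'M[C]_(r, c)))).
  by rewrite rank_pid_mx.
rewrite pidE SE; apply: leq_trans (mxrankM_maxr _ _) _.
exact: leq_trans (mxrankM_maxl _ _) (mxrankM_maxr _ _).
Qed.

End SingularValues.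

(** * An abstract inversion estimate with explicit constants *)

Section ApproximateInverse.
Context {R : realType}.
Local Notation C := R[i].
(** In the application [S] is the row sketch, [G] is [A^* A], [W] the projection on the row space of
    [A], [N'] the matrix [C C^*], [T] its pseudoinverse and [P] the projection on its range. *)
Variables (n r : nat) (S : 'M[C]_(r, n)) (G W E1 : 'M[C]_n) (N' T P E2 : 'M[C]_r).
Variables (K eps t1 t2 : R).
Local Notation N := (S *m S^t*).

Hypothesis K_ge1 : 1 <= K.
Hypothesis eps_gt0 : 0 < eps.
Hypothesis eps_lt1 : eps < 1.
Hypothesis t1_ge0 : 0 <= t1.
Hypothesis t2_ge0 : 0 <= t2.
Hypothesis t1E : t1 * K ^+ 2 = eps / 5.
Hypothesis t2E : t2 * K ^+ 4 = eps / 12.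
Hypothesis S_lower : forall x : 'cV_n, W *m x = x -> fnorm x <= 9 / 8 * K * fnorm (S *m x).
Hypothesis S_upper : forall x : 'cV_n, fnorm (S *m x) <= 11 / 10 * fnorm x.
Hypothesis W_adjS : forall y : 'cV_r, W *m (S^t* *m y) = S^t* *m y.
Hypothesis E1_le : forall x : 'cV_n, fnorm (E1 *m x) <= t1 * fnorm x.
Hypothesis E2_le : forall y : 'cV_r, fnorm (E2 *m y) <= t2 * fnorm y.
Hypothesis GE : G = S^t* *m S - E1.
Hypothesis NE : N = N' - E2.
Hypothesis N'T : N' *m T = P.
Hypothesis TN' : T *m N' = P.
Hypothesis PT : P *m T = T.
Hypothesis TP : T *m P = T.
Hypothesis PP : P *m P = P.
Hypothesis N'P : N' *m (1%:M - P) = 0.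
Hypothesis T_adj : T^t* = T.
Hypothesis P_adj : P^t* = P.
Hypothesis T_le : forall y : 'cV_r, fnorm (T *m y) <= 7 / 5 * K ^+ 2 * fnorm y.
Hypothesis P_le : forall y : 'cV_r, fnorm (P *m y) <= fnorm y.
Hypothesis P'_le : forall y : 'cV_r, fnorm ((1%:M - P) *m y) <= fnorm y.

Let K_ge0 : 0 <= K. Proof. by have := K_ge1; lra. Qed.

(** The sum of the bounds [b1] to [b6] in [approximate_inverse], divided by [fnorm x] and multiplied
    by the constant of [S_lower]. *)
Let error_budget_lhs := 9 / 8 * K * (9 / 8 * K * t2
  + 7 / 5 * K ^+ 2 * (t2 * (11 / 10)) + t2 * (7 / 5 * K ^+ 2 * (11 / 10))
  + t2 * (7 / 5 * K ^+ 2 * (7 / 5 * K ^+ 2 * (t2 * (11 / 10))))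
  + (63 / 50 * K * t1 + t2 * (7 / 5 * K ^+ 2 * (63 / 50 * K * t1)))).

(** As [K >= 1], every monomial is controlled by [t1 * K ^ 2 = eps / 5] and [t2 * K ^ 4 = eps / 12];
    the total is about [0.73 * eps]. *)
Lemma error_budget : error_budget_lhs <= 4 / 5 * eps.
Proof.
have [eps0 eps1] := (eps_gt0, eps_lt1).
have K2 : 1 <= K ^+ 2 by exact: exprn_ege1.
have t2K2 : t2 * K ^+ 2 <= eps / 12.
  rewrite -t2E ler_wpM2l // -subr_ge0 (_ : _ - _ = K ^+ 2 * (K ^+ 2 - 1)); last by ring.
  by rewrite mulr_ge0 ?sqr_ge0 // subr_ge0.
have t2K3 : t2 * K ^+ 3 <= eps / 12.
  rewrite -t2E ler_wpM2l // -subr_ge0 (_ : _ - _ = K ^+ 3 * (K - 1)); last by ring.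
  by rewrite mulr_ge0 ?exprn_ge0 ?subr_ge0.
have t2K1 : t2 * K <= eps / 12.
  by apply: le_trans t2K2; rewrite ler_wpM2l // expr2 -{1}[K]mulr1 ler_wpM2l.
have t22 : t2 ^+ 2 * K ^+ 5 <= eps / 144.
  rewrite (_ : _ * _ = (t2 * K ^+ 4) * (t2 * K)); last by ring.
  rewrite t2E; apply: (le_trans (y := eps / 12 * (1 / 12))); last by lra.
  by apply: ler_wpM2l; lra.
have t12 : t1 * t2 * K ^+ 4 <= eps / 60.
  rewrite -[leLHS]mulrA t2E; have : t1 <= 1 / 5.
    have : 0 <= t1 * (K ^+ 2 - 1) by rewrite mulr_ge0 ?subr_ge0.
    rewrite mulrBr t1E; lra.
  move=> t15; apply: (le_trans (y := 1 / 5 * (eps / 12))); last by lra.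
  by rewrite ler_wpM2r //; lra.
rewrite /error_budget_lhs.
rewrite [leLHS](_ : _ = 81 / 64 * (t2 * K ^+ 2) + 9 / 8 * (14 / 5 * 11 / 10 * (t2 * K ^+ 3)
  + 49 / 25 * 11 / 10 * (t2 ^+ 2 * K ^+ 5) + 63 / 50 * (t1 * K ^+ 2)
  + 63 / 50 * 7 / 5 * (t1 * t2 * K ^+ 4))); last by field.
rewrite t1E; lra.
Qed.

(* The range of [P] may be smaller than that of [S]; no rank argument is needed,
   because [N (1 - P) = - E2 (1 - P)] is small anyway. *)
Lemma fnorm_compl_proj (x : 'cV[C]_n) :
  fnorm ((1%:M - P) *m (S *m x)) <= 9 / 8 * K * t2 * fnorm x.
Proof.
rewrite mulmxA -[_ *m S]trmxCK; apply: fnorm_adj_le => [|y].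
  by rewrite !mulr_ge0 //; lra.
rewrite adjmxM adjmxB adjmx1 P_adj -mulmxA.
apply: le_trans (S_lower (W_adjS _)) _; rewrite -[leRHS]mulrA ler_wpM2l //.
  by rewrite !mulr_ge0 //; lra.
rewrite mulmxA NE mulmxBl mulmxA N'P mul0mx sub0r fnormN.
by apply: le_trans (E2_le _) _; rewrite ler_wpM2l.
Qed.

(** The square equals the inner product of [T y] with [N T y], and [N T = P - E2 T]. This gives
    growth of order [K], where bounding [T] alone would give [K ^ 2]. The constant comes from
    [7 / 5 + 49 / 300 < (63 / 50) ^ 2]. *)
Lemma fnorm_adjS_T (y : 'cV[C]_r) : fnorm (S^t* *m (T *m y)) <= 63 / 50 * K * fnorm y.
Proof.
have y0 := fnorm_ge0 y.
rewrite -(@ler_pXn2r _ 2) ?nnegrE ?fnorm_ge0 //; last by rewrite !mulr_ge0 //; lra.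
have -> : fnorm (S^t* *m (T *m y)) ^+ 2
    = rdot (T *m y) y - rdot (T *m y) (E2 *m (T *m y)).
  rewrite fnorm_sqr [LHS]rdot_adjl trmxCK [S *m _]mulmxA NE mulmxBl.
  rewrite [N' *m _]mulmxA N'T rdotDr rdotNr; congr (_ - _).
  by rewrite rdot_adjr P_adj mulmxA PT.
have h1 : rdot (T *m y) y <= 7 / 5 * K ^+ 2 * fnorm y ^+ 2.
  apply: le_trans (rdot_le _ _) _; rewrite expr2 mulrA ler_wpM2r //.
have h2 : `|rdot (T *m y) (E2 *m (T *m y))| <= t2 * fnorm (T *m y) ^+ 2.
  apply: le_trans (rdot_abs_le _ _) _.
  by rewrite expr2 mulrCA ler_wpM2l ?fnorm_ge0.
rewrite ler_norml in h2; case/andP: h2 => h2 _.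
have h3 : t2 * fnorm (T *m y) ^+ 2 <= t2 * (7 / 5 * K ^+ 2 * fnorm y) ^+ 2.
  rewrite ler_wpM2l // ler_pXn2r ?nnegrE ?fnorm_ge0 // !mulr_ge0 //; lra.
have h4 : t2 * (7 / 5 * K ^+ 2 * fnorm y) ^+ 2
    = 49 / 25 * (eps / 12) * fnorm y ^+ 2 by rewrite -t2E; field.
have y2 : 0 <= fnorm y ^+ 2 by exact: sqr_ge0.
have h5 : eps * fnorm y ^+ 2 <= K ^+ 2 * fnorm y ^+ 2.
  by rewrite ler_wpM2r // (le_trans (ltW eps_lt1)) // exprn_ege1.
have h6 : 0 <= K ^+ 2 * fnorm y ^+ 2 by rewrite mulr_ge0 ?sqr_ge0.
rewrite !exprMn; lra.
Qed.

Lemma fnorm_T_S (x : 'cV[C]_n) : fnorm (T *m (S *m x)) <= 63 / 50 * K * fnorm x.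
Proof.
rewrite mulmxA -[T *m S]trmxCK; apply: fnorm_adj_le => [|y].
  by rewrite !mulr_ge0 //; lra.
by rewrite adjmxM T_adj -mulmxA fnorm_adjS_T.
Qed.

Let NT_expand : N *m T = P - E2 *m T.
Proof. by rewrite NE mulmxBl N'T. Qed.

Let NTTN_expand :
  N *m T *m (T *m N) = P - T *m E2 - E2 *m T + E2 *m (T *m (T *m E2)).
Proof.
have TN : T *m N = P - T *m E2 by rewrite NE mulmxBr TN'.
rewrite NT_expand TN mulmxBl !mulmxBr PP [P *m (T *m _)]mulmxA PT.
rewrite -[E2 *m T *m P]mulmxA TP -[E2 *m T *m _]mulmxA opprB addrA.
exact: addrAC.
Qed.

Let NTT_mul (z : 'cV[C]_r) :
  S *m (S^t* *m (T *m (T *m z))) = P *m (T *m z) - E2 *m (T *m (T *m z)).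
Proof.
transitivity (N *m T *m (T *m z)); first by rewrite -!mulmxA.
by rewrite NT_expand mulmxBl -!mulmxA.
Qed.

Let NTTN_mul (y : 'cV[C]_r) :
  S *m (S^t* *m (T *m (T *m (S *m (S^t* *m y)))))
  = P *m y - T *m (E2 *m y) - E2 *m (T *m y) + E2 *m (T *m (T *m (E2 *m y))).
Proof.
transitivity (N *m T *m (T *m N) *m y); first by rewrite -!mulmxA.
by rewrite NTTN_expand mulmxDl !mulmxBl -!mulmxA.
Qed.

(* [S^* T^2 S] inverts [G] approximately on the range of [W]; as
   [S S^* T^2 S S^*] is close to the projection [P], the error is measured
   after applying [S]. *)
Lemma approximate_inverse (x : 'cV[C]_n) : W *m x = x ->
  fnorm (S^t* *m (T *m (T *m (S *m (G *m x)))) - x) <= 4 / 5 * eps * fnorm x.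
Proof.
move=> Wx.
have K9 : 0 <= 9 / 8 * K by rewrite mulr_ge0 //; lra.
have K63 : 0 <= 63 / 50 * K by rewrite mulr_ge0 //; lra.
have k20 : 0 <= 7 / 5 * K ^+ 2 by rewrite mulr_ge0 ?sqr_ge0 //; lra.
have triangle6 (u v w z p q : 'cV[C]_r) : fnorm (- u - v - w + z - (p - q))
    <= fnorm u + fnorm v + fnorm w + fnorm z + (fnorm p + fnorm q).
  apply: le_trans (fnormD _ _) _; rewrite fnormN; apply: lerD; last first.
    by apply: le_trans (fnormD _ _) _; rewrite fnormN.
  apply: le_trans (fnormD _ _) _; rewrite lerD2r.
  apply: le_trans (fnormD _ _) _; rewrite fnormN lerD2r.
  by apply: le_trans (fnormD _ _) _; rewrite !fnormN.
have V_mem : W *m (S^t* *m (T *m (T *m (S *m (G *m x)))) - x)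
    = S^t* *m (T *m (T *m (S *m (G *m x)))) - x.
  by rewrite mulmxBr W_adjS Wx.
apply: le_trans (S_lower V_mem) _.
have [y yE] : exists y, y = S *m x by exists (S *m x).
have [e eE] : exists e, e = E1 *m x by exists (E1 *m x).
(* Inserting [G = S^* S - E1] splits the image into [N T T N y] and [N T T S e]. Expanding [N]
   around [N'] leaves the main term [P y], and every other term carries [E2] or [e]. *)
have -> : S *m (S^t* *m (T *m (T *m (S *m (G *m x)))) - x)
    = - ((1%:M - P) *m y) - T *m (E2 *m y) - E2 *m (T *m y)
      + E2 *m (T *m (T *m (E2 *m y)))
      - (P *m (T *m (S *m e)) - E2 *m (T *m (T *m (S *m e)))).
  have sub_compl (Z : zmodType) (u v a b d w : Z) :
      a - b - d + w - u - v = - (v - a) - b - d + w - u.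
    by rewrite opprB -!addrA; congr (_ + _); rewrite !addrA [LHS]addrC !addrA.
  rewrite GE mulmxBl -[S^t* *m S *m x]mulmxA -yE -eE.
  rewrite !(mulmxBr S, mulmxBr T, mulmxBr (S^t* )) -yE NTTN_mul NTT_mul.
  by rewrite mulmxBl mul1mx sub_compl.
have x0 := fnorm_ge0 x; have y_le : fnorm y <= 11 / 10 * fnorm x by rewrite yE.
have t3 : fnorm e <= t1 * fnorm x by rewrite eE.
set k2 := 7 / 5 * K ^+ 2.
rewrite -/k2 in k20.
have b1 : fnorm ((1%:M - P) *m y) <= 9 / 8 * K * t2 * fnorm x.
  by rewrite yE fnorm_compl_proj.
have E2y : fnorm (E2 *m y) <= t2 * (11 / 10 * fnorm x).
  by apply: le_trans (E2_le _) _; rewrite ler_wpM2l.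
have b2 : fnorm (T *m (E2 *m y)) <= k2 * (t2 * (11 / 10 * fnorm x)).
  by apply: le_trans (T_le _) _; rewrite ler_wpM2l.
have b3 : fnorm (E2 *m (T *m y)) <= t2 * (k2 * (11 / 10 * fnorm x)).
  apply: le_trans (E2_le _) _; rewrite ler_wpM2l //.
  by apply: le_trans (T_le _) _; rewrite ler_wpM2l.
have b4 : fnorm (E2 *m (T *m (T *m (E2 *m y))))
    <= t2 * (k2 * (k2 * (t2 * (11 / 10 * fnorm x)))).
  apply: le_trans (E2_le _) _; rewrite ler_wpM2l //.
  by apply: le_trans (T_le _) _; rewrite ler_wpM2l.
have q_le : fnorm (T *m (S *m e)) <= 63 / 50 * K * (t1 * fnorm x).
  by apply: le_trans (fnorm_T_S _) _; apply: ler_wpM2l.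
have b5 : fnorm (P *m (T *m (S *m e))) <= 63 / 50 * K * (t1 * fnorm x).
  exact: le_trans (P_le _) q_le.
have b6 : fnorm (E2 *m (T *m (T *m (S *m e))))
    <= t2 * (k2 * (63 / 50 * K * (t1 * fnorm x))).
  apply: le_trans (E2_le _) _; rewrite ler_wpM2l //.
  by apply: le_trans (T_le _) _; rewrite ler_wpM2l.
apply: (le_trans (y := 9 / 8 * K * (9 / 8 * K * t2 * fnorm x
   + k2 * (t2 * (11 / 10 * fnorm x)) + t2 * (k2 * (11 / 10 * fnorm x))
   + t2 * (k2 * (k2 * (t2 * (11 / 10 * fnorm x))))
   + (63 / 50 * K * (t1 * fnorm x) + t2 * (k2 * (63 / 50 * K * (t1 * fnorm x))))))).
  apply: ler_wpM2l; first exact: K9.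
  apply: le_trans (triangle6 _ _ _ _ _ _) _.
  exact: (lerD (lerD (lerD (lerD b1 b2) b3) b4) (lerD b5 b6)).
rewrite [leLHS](_ : _ = error_budget_lhs * fnorm x).
  by rewrite ler_wpM2r // error_budget.
rewrite /k2 /error_budget_lhs; ring.
Qed.

End ApproximateInverse.

(** * Deterministic error analysis of the sketched solution *)

Section Perturbation.
Context {R : realType}.
Local Notation C := R[i].
Variables (m n r c : nat) (A : 'M[C]_(m, n)) (X : 'M[C]_(n, m)).
(** Sampling enters through the factors [M1] and [M2] alone: the rows of [M1 A] lie in the row space
    of [A], and the range of [M1 A M2] lies in that of [M1 A]. *)
Variables (M1 : 'M[C]_(r, m)) (M2 : 'M[C]_(n, c)).
Variables (U : 'M[C]_r) (sigma : nat -> R) (V : 'M[C]_c).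
Variables (K eps t1 t2 : R).
Local Notation Rs := (M1 *m A).
Local Notation Cs := (M1 *m A *m M2).
Local Notation E1 := (Rs^t* *m Rs - A^t* *m A).
Local Notation E2 := (Cs *m Cs^t* - Rs *m Rs^t*).

Hypothesis pinvX : is_pinv A X.
Hypothesis A_le : forall x : 'cV_n, fnorm (A *m x) <= fnorm x.
Hypothesis X_le : forall y : 'cV_m, fnorm (X *m y) <= K * fnorm y.
Hypothesis K_ge1 : 1 <= K.
Hypothesis eps01 : 0 < eps < 1.
Hypothesis t1E : t1 * K ^+ 2 = eps / 5.
Hypothesis t2E : t2 * K ^+ 4 = eps / 12.
Hypothesis E1_le : fnorm E1 <= t1.
Hypothesis E2_le : fnorm E2 <= t2.
Hypothesis svd : is_svd Cs U sigma V.

Let AXA : A *m X *m A = A. Proof. by case: pinvX. Qed.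
Let XAX : X *m A *m X = X. Proof. by case: pinvX. Qed.
Let AXt : (A *m X)^t* = A *m X. Proof. by case: pinvX. Qed.
Let XAt : (X *m A)^t* = X *m A. Proof. by case: pinvX. Qed.
Let K_gt0 : 0 < K. Proof. exact: lt_le_trans ltr01 K_ge1. Qed.
Let K2_ge1 : 1 <= K ^+ 2. Proof. exact: exprn_ege1. Qed.
Let eps_gt0 : 0 < eps. Proof. by case/andP: eps01. Qed.
Let eps_lt1 : eps < 1. Proof. by case/andP: eps01. Qed.
Let t1_ge0 : 0 <= t1. Proof. exact: le_trans (fnorm_ge0 _) E1_le. Qed.
Let t2_ge0 : 0 <= t2. Proof. exact: le_trans (fnorm_ge0 _) E2_le. Qed.

Let t2K2 : t2 * K ^+ 2 <= eps / 12.
Proof.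
rewrite -t2E ler_wpM2l // -subr_ge0 (_ : _ - _ = K ^+ 2 * (K ^+ 2 - 1)); last by ring.
by rewrite mulr_ge0 ?sqr_ge0 // subr_ge0.
Qed.

Let t2K3 : t2 * K ^+ 3 <= eps / 12.
Proof.
rewrite -t2E ler_wpM2l // -subr_ge0 (_ : _ - _ = K ^+ 3 * (K - 1)); last by ring.
by rewrite mulr_ge0 ?exprn_ge0 ?subr_ge0 // ltW.
Qed.

Let E1_mul (x : 'cV[C]_n) : fnorm (E1 *m x) <= t1 * fnorm x.
Proof.
by apply: le_trans (fnorm_mulmx_col _ _) _; rewrite ler_wpM2r ?fnorm_ge0.
Qed.

Let E2_mul (y : 'cV[C]_r) : fnorm (E2 *m y) <= t2 * fnorm y.
Proof.
by apply: le_trans (fnorm_mulmx_col _ _) _; rewrite ler_wpM2r ?fnorm_ge0.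
Qed.

Let rdot_mul_le p (E : 'M[C]_p) (t : R) (x : 'cV[C]_p) :
  (forall y : 'cV_p, fnorm (E *m y) <= t * fnorm y) ->
  `|rdot x (E *m x)| <= t * fnorm x ^+ 2.
Proof.
move=> Et; apply: le_trans (rdot_abs_le _ _) _.
by rewrite expr2 mulrCA ler_wpM2l ?fnorm_ge0.
Qed.

(** On the row space [|x| <= K |A x|]. Replacing [A] by the sketch costs at most
    [t1 K ^ 2 |x| ^ 2 <= |x| ^ 2 / 5], and absorbing this on the left produces [5 / 4]. *)
Lemma fnorm_row_space (x : 'cV[C]_n) : X *m A *m x = x ->
  fnorm x ^+ 2 <= 5 / 4 * K ^+ 2 * fnorm (Rs *m x) ^+ 2.
Proof.
move=> XAx; set f := fnorm x ^+ 2; set g := fnorm (Rs *m x) ^+ 2.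
have f_ge0 : 0 <= f by exact: sqr_ge0.
have h1 : f <= K ^+ 2 * fnorm (A *m x) ^+ 2.
  rewrite -exprMn ler_pXn2r ?nnegrE ?mulr_ge0 ?fnorm_ge0 ?(ltW K_gt0) //.
  by rewrite -{1}XAx -mulmxA X_le.
have h2 : fnorm (A *m x) ^+ 2 = g - rdot x (E1 *m x).
  rewrite /g !fnorm_sqr !rdot_adjl mulmxBl -rdotNr -rdotDr opprB !mulmxA.
  by rewrite addrC subrK.
have h3 := rdot_mul_le x E1_mul; rewrite ler_norml in h3; case/andP: h3 => h3 _.
have h4 : K ^+ 2 * fnorm (A *m x) ^+ 2 <= K ^+ 2 * g + t1 * K ^+ 2 * f.
  rewrite h2 (_ : _ + t1 * _ * f = K ^+ 2 * (g + t1 * f)); last by ring.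
  by rewrite ler_wpM2l ?sqr_ge0 // lerD2l lerNl.
have h5 : eps / 5 * f <= f / 5 by have := eps_lt1; nra.
rewrite t1E in h4; lra.
Qed.

(** Square root of the previous bound, as [5 / 4 < (9 / 8) ^ 2]. *)
Lemma fnorm_row_space_le (x : 'cV[C]_n) : X *m A *m x = x ->
  fnorm x <= 9 / 8 * K * fnorm (Rs *m x).
Proof.
move=> /fnorm_row_space h; have K2 : 0 <= K ^+ 2 by exact: sqr_ge0.
have g2 : 0 <= K ^+ 2 * fnorm (Rs *m x) ^+ 2 by rewrite mulr_ge0 ?sqr_ge0.
have K_ge0 := ltW K_gt0; have g_ge0 := fnorm_ge0 (Rs *m x).
rewrite -(@ler_pXn2r _ 2) ?nnegrE ?fnorm_ge0 //; last by rewrite !mulr_ge0 //; lra.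
apply: le_trans h _; rewrite !exprMn; lra.
Qed.

(** [K >= 1] forces [t1 <= 1 / 5], and [1 + 1 / 5 < (11 / 10) ^ 2]. *)
Lemma fnorm_Rs_le (x : 'cV[C]_n) : fnorm (Rs *m x) <= 11 / 10 * fnorm x.
Proof.
have f_ge0 : 0 <= fnorm x ^+ 2 by exact: sqr_ge0.
have f0 := fnorm_ge0 x; rewrite -(@ler_pXn2r _ 2) ?nnegrE ?fnorm_ge0 //; last lra.
have h2 : fnorm (Rs *m x) ^+ 2 = fnorm (A *m x) ^+ 2 + rdot x (E1 *m x).
  rewrite !fnorm_sqr !rdot_adjl mulmxBl rdotDr rdotNr !mulmxA.
  by rewrite addrC subrK.
have h3 := rdot_mul_le x E1_mul; rewrite ler_norml in h3; case/andP: h3 => _ h3.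
have h1 : fnorm (A *m x) ^+ 2 <= fnorm x ^+ 2.
  by rewrite ler_pXn2r ?nnegrE ?fnorm_ge0.
have h4 : t1 <= 1 / 5.
  have : 0 <= t1 * (K ^+ 2 - 1) by rewrite mulr_ge0 ?subr_ge0.
  rewrite mulrBr t1E; have := eps_lt1; lra.
have h5 : t1 * fnorm x ^+ 2 <= 1 / 5 * fnorm x ^+ 2 by rewrite ler_wpM2r.
rewrite h2 exprMn; lra.
Qed.

Let Rs_row_space : Rs *m (X *m A) = Rs.
Proof. by rewrite -mulmxA [A *m (_ *m _)]mulmxA AXA. Qed.

Let adj_Rs_row_space (y : 'cV[C]_r) : X *m A *m (Rs^t* *m y) = Rs^t* *m y.
Proof. by rewrite mulmxA -{1}XAt -adjmxM Rs_row_space. Qed.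

Local Notation N' := (Cs *m Cs^t*).
Local Notation N := (Rs *m Rs^t*).
(** The convention [0^-1 = 0] makes [T] vanish on the kernel of [N'], as a pseudoinverse does. *)
Local Notation P := (udiag U (fun l => (sigma l != 0)%:R)).
Local Notation T := (udiag U (fun l => (sigma l ^+ 2)^-1)).

Let Uu : U \is unitarymx. Proof. by case: svd. Qed.
Let sigma_ge0 l : 0 <= sigma l. Proof. by case: svd => _ _ _ [h _] _. Qed.
Let N'E : N' = udiag U (fun l => sigma l ^+ 2). Proof. exact: svd_gram svd. Qed.

Let N'T : N' *m T = P.
Proof.
rewrite N'E (udiagM Uu); apply: eq_udiag => l.
case: eqVneq => [->|s0]; first by rewrite expr0n mul0r.
by rewrite divff ?sqrf_eq0.
Qed.

Let TN' : T *m N' = P.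
Proof.
rewrite N'E (udiagM Uu); apply: eq_udiag => l.
case: eqVneq => [->|s0]; first by rewrite expr0n mulr0.
by rewrite mulVf ?sqrf_eq0.
Qed.

Let PT : P *m T = T.
Proof.
rewrite (udiagM Uu); apply: eq_udiag => l.
case: eqVneq => [->|s0]; first by rewrite expr0n invr0 mulr0.
by rewrite mul1r.
Qed.

Let TP : T *m P = T.
Proof.
rewrite (udiagM Uu); apply: eq_udiag => l.
case: eqVneq => [->|s0]; first by rewrite expr0n invr0 mul0r.
by rewrite mulr1.
Qed.

Let PP : P *m P = P.
Proof.
by rewrite (udiagM Uu); apply: eq_udiag => l; case: (_ != _); rewrite ?mulr0 ?mulr1.
Qed.

Let PN' : N' *m (1%:M - P) = 0.
Proof.
rewrite N'E mulmxBr mulmx1 (udiagM Uu) (eq_udiag U (e := fun l => sigma l ^+ 2)) ?subrr //.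
move=> l; case: eqVneq => [->|_]; first by rewrite expr0n mul0r.
by rewrite mulr1.
Qed.

(** A left singular vector [w] with nonzero singular value is [Rs y] for some [y] in the row space,
    with [|y| ^ 2 <= 5 / 4 K ^ 2]. Hence [1 = |w| ^ 2 <= |Rs^* w| |y|], while [|Rs^* w| ^ 2] is
    within [t2] of [sigma l ^ 2]. So [K ^ 2 * sigma l ^ 2] is at least [4 / 5 - 1 / 12 > 5 / 7]. *)
Lemma singular_value_lower (l : 'I_r) :
  sigma l != 0 -> (sigma l ^+ 2)^-1 <= 7 / 5 * K ^+ 2.
Proof.
move=> s0; have s_gt0 : 0 < sigma l ^+ 2 by rewrite exprn_gt0 // lt_def s0 sigma_ge0.
set w := col l U; set s := sigma l ^+ 2 in s_gt0 *.
have w1 : fnorm w = 1.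
  rewrite /w colE fnorm_unitary_mul //.
  apply/eqP; rewrite -(@eqrXn2 _ 2) ?fnorm_ge0 // expr1n fnorm_sqrE.
  rewrite (bigD1 l) //= big_ord1 mxE !eqxx big1 ?addr0 => [|i il].
    by rewrite ComplexField.Normc.normc1 expr1n.
  by rewrite big_ord1 mxE (negPf il) ComplexField.Normc.normc0 expr0n.
have N'w : N' *m w = s%:C *: w by rewrite N'E udiag_col.
(* [Cs Cs^* w = s w] exhibits [w] as an image under [Rs]; projecting the preimage on the row space
   does not change its image. *)
set y := X *m A *m (M2 *m (Cs^t* *m ((s^-1)%:C *: w))).
have wE : w = Rs *m y.
  rewrite /y mulmxA Rs_row_space mulmxA [Rs *m M2 *m _]mulmxA -scalemxAr N'w.
  by rewrite scalerA -rmorphM mulVf ?gt_eqF // scale1r.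
have yV : X *m A *m y = y by rewrite /y !mulmxA -[X *m A *m X]mulmxA mulmxA XAX.
have := fnorm_row_space yV; rewrite -wE w1 expr1n mulr1 => y_le.
have Rw : 1 <= fnorm (Rs^t* *m w) * fnorm y.
  apply: le_trans (rdot_le _ _); rewrite rdot_adjl trmxCK -wE -fnorm_sqr w1.
  by rewrite expr1n.
have Rw2 : 1 <= fnorm (Rs^t* *m w) ^+ 2 * (5 / 4 * K ^+ 2).
  apply: le_trans (_ : (fnorm (Rs^t* *m w) * fnorm y) ^+ 2 <= _).
    exact: exprn_ege1.
  by rewrite exprMn ler_wpM2l ?sqr_ge0.
have Nw : fnorm (Rs^t* *m w) ^+ 2 = s - rdot w (E2 *m w).
  rewrite mulmxBl N'w rdotDr rdotNr rdotZr -fnorm_sqr w1 expr1n mulr1.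
  by rewrite opprB addrC subrK fnorm_sqr rdot_adjl trmxCK mulmxA.
have h3 := rdot_mul_le w E2_mul.
rewrite w1 expr1n mulr1 ler_norml in h3; case/andP: h3 => h3 _.
have h4 : fnorm (Rs^t* *m w) ^+ 2 * K ^+ 2 <= s * K ^+ 2 + t2 * K ^+ 2.
  by rewrite -mulrDl ler_wpM2r ?sqr_ge0 // Nw lerD2l lerNl.
have h5 := t2K2; have h6 := eps_lt1.
rewrite -[_^-1]mul1r ler_pdivrMr //; lra.
Qed.

(** With [N'] in place of [N] the square would be exactly the sum. The correction is at most
    [t2 |f| ^ 2], and [singular_value_lower] bounds it by [7 / 60] of the sum, as [f] is supported
    on nonzero singular values. *)
Lemma fnorm_coefficient_error (f : 'cV[C]_r) :
    (forall l : 'I_r, sigma l = 0 -> f l 0 = 0) ->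
  fnorm (Rs^t* *m (U *m f)) ^+ 2
    <= 67 / 60 * \sum_(l < r) sigma l ^+ 2 * ComplexField.Normc.normc (f l 0) ^+ 2.
Proof.
move=> f0; set Q := \sum_(_ < _) _; set z := U *m f.
have zN : fnorm (Rs^t* *m z) ^+ 2 = rdot z (N' *m z) - rdot z (E2 *m z).
  by rewrite mulmxBl rdotDr rdotNr opprB addrC subrK fnorm_sqr rdot_adjl trmxCK mulmxA.
have zN' : rdot z (N' *m z) = Q.
  have -> : N' = udiag U sigma *m udiag U sigma.
    by rewrite N'E (udiagM Uu); apply: eq_udiag.
  rewrite -mulmxA rdot_adjr udiag_adj -fnorm_sqr /z /udiag -!mulmxA.
  rewrite [U^t* *m (U *m f)]mulmxA (mulmx1C (elimT unitarymxP Uu)) mul1mx.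
  rewrite (fnorm_unitary_mul Uu) fnorm_sqrE; apply: eq_bigr => l _.
  rewrite big_ord1 mul_diag_mx !mxE ComplexField.Normc.normcM exprMn.
  by rewrite [X in X * _]normc_sqr conjC_real -rmorphM expr2.
have fQ : fnorm z ^+ 2 <= 7 / 5 * K ^+ 2 * Q.
  rewrite (fnorm_unitary_mul Uu) fnorm_sqrE mulr_sumr; apply: ler_sum => l _.
  rewrite big_ord1 mulrA -[leLHS]mul1r.
  have [s0|s0] := eqVneq (sigma l) 0.
    by rewrite (f0 l s0) ComplexField.Normc.normc0 expr0n !mulr0.
  rewrite ler_wpM2r ?sqr_ge0 // -ler_pdivrMr ?exprn_gt0 ?lt_def ?s0 ?sigma_ge0 //.
  by rewrite mul1r singular_value_lower.
have Q_ge0 : 0 <= Q by apply: sumr_ge0 => l _; rewrite mulr_ge0 ?sqr_ge0.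
have h3 := rdot_mul_le z E2_mul; rewrite ler_norml in h3; case/andP: h3 => h3 _.
have h4 : t2 * fnorm z ^+ 2 <= t2 * (7 / 5 * K ^+ 2 * Q) by rewrite ler_wpM2l.
have h5 : t2 * K ^+ 2 * Q <= 1 / 12 * Q.
  by rewrite ler_wpM2r //; have := t2K2; have := eps_lt1; lra.
rewrite zN zN'; lra.
Qed.

Lemma svd_approximate_inverse (x : 'cV[C]_n) : X *m A *m x = x ->
  fnorm (Rs^t* *m (T *m (T *m (Rs *m (A^t* *m A *m x)))) - x) <= 4 / 5 * eps * fnorm x.
Proof.
have T_le (l : 'I_r) : `|(sigma l ^+ 2)^-1| <= 7 / 5 * K ^+ 2.
  rewrite ger0_norm ?invr_ge0 ?sqr_ge0 //.
  have [->|s0] := eqVneq (sigma l) 0; last exact: singular_value_lower.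
  by rewrite expr0n invr0 mulr_ge0 ?sqr_ge0 //; lra.
have T_ge0 : 0 <= 7 / 5 * K ^+ 2 by rewrite mulr_ge0 ?sqr_ge0 //; lra.
have GE : A^t* *m A = Rs^t* *m Rs - E1 by rewrite opprB addrC subrK.
have NE : N = N' - E2 by rewrite opprB addrC subrK.
have P_le (y : 'cV[C]_r) : fnorm (P *m y) <= fnorm y.
  rewrite -[leRHS]mul1r; apply: udiag_le => // l.
  by case: (_ != _); rewrite ?normr0 ?normr1.
have P'_le (y : 'cV[C]_r) : fnorm ((1%:M - P) *m y) <= fnorm y.
  rewrite -(udiag1 Uu) udiagB -[leRHS]mul1r; apply: udiag_le => // l.
  by case: (_ != _); rewrite ?subrr ?subr0 ?normr0 ?normr1.
exact: (approximate_inverse K_ge1 eps_gt0 eps_lt1 t1_ge0 t2_ge0 t1E t2E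
  fnorm_row_space_le fnorm_Rs_le adj_Rs_row_space E1_mul E2_mul GE NE
  N'T TN' PT TP PP PN' (udiag_adj _ _) (udiag_adj _ _)
  (fun y => udiag_le Uu y T_le T_ge0) P_le P'_le).
Qed.

(** The exact coefficients [mu] give the vector of [svd_approximate_inverse]. The deviation [f l]
    satisfies [sigma l |f l| <= delta eps |b| / sqrt k], so the squares of at most [k] such terms
    add up to [(delta eps |b|) ^ 2]; finally [67 / 60 < (11 / 10) ^ 2]. *)
Lemma sketch_output_error (k : nat) (delta : R) (b : 'cV[C]_m) (lambda : 'I_r -> C) :
    (\rank A <= k)%N -> (1 <= k)%N -> 0 <= delta ->
    (forall l : 'I_r, (l < k)%N ->
       ComplexField.Normc.normc
         (lambda l - inner (((sigma l)%:C)^-1 *: (Rs^t* *m col l U)) (A^t* *m b))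
       <= delta * (eps * sigma l ^+ 2 * fnorm b / Num.sqrt k%:R)) ->
  fnorm (Rs^t* *m (\sum_(l < r | (l < k)%N) (lambda l / (sigma l)%:C ^+ 3) *: col l U)
         - X *m b)
    <= 4 / 5 * eps * fnorm (X *m b) + 11 / 10 * (delta * eps * fnorm b).
Proof.
move=> rankA k1 delta0 lambdaE.
(* The sketch has rank at most [k], so truncating the sum at [k] discards only zero singular
   values. *)
have sigma0 (l : 'I_r) : (k <= l)%N -> sigma l = 0.
  apply: (svd_rank svd); apply: leq_trans rankA.
  exact: leq_trans (mxrankM_maxl _ _) (mxrankM_maxr _ _).
(* The normal equations for the least-squares solution [X b]. *)
have Atb : A^t* *m b = A^t* *m A *m (X *m b).
  by rewrite mulmxA -[A^t* *m A *m X]mulmxA -AXt -adjmxM AXA.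
pose mu (l : 'I_r) := inner (((sigma l)%:C)^-1 *: (Rs^t* *m col l U)) (A^t* *m b).
have {}lambdaE (l : 'I_r) : (l < k)%N -> ComplexField.Normc.normc (lambda l - mu l)
    <= delta * (eps * sigma l ^+ 2 * fnorm b / Num.sqrt k%:R) by exact: lambdaE.
pose y := Rs *m (A^t* *m A *m (X *m b)).
have muE l : mu l = ((sigma l)%:C)^-1 * (U^t* *m y) l 0.
  rewrite /mu /inner Atb -fmorphV /= adjmxZ -scalemxAl mxE; congr (_ * _).
  rewrite adjmxM trmxCK -mulmxA -row_adj -/y.
  by rewrite -row_mul mxE.
pose f : 'cV[C]_r := \col_l if (l < k)%N then (lambda l - mu l) / (sigma l)%:C ^+ 3 else 0.
have sum_col (h : 'cV[C]_r) : U *m h = \sum_l h l 0 *: col l U.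
  apply/matrixP => i j; rewrite mxE summxE; apply: eq_bigr => l _.
  by rewrite !mxE mulrC (ord1 j).
have -> : \sum_(l < r | (l < k)%N) (lambda l / (sigma l)%:C ^+ 3) *: col l U
    = T *m (T *m y) + U *m f.
  rewrite mulmxA (udiagM Uu) /udiag -!mulmxA -mulmxDr sum_col big_mkcond /=.
  apply: eq_bigr => l _; rewrite mul_diag_mx !mxE.
  case: ltnP => [lk|kl]; last by rewrite (sigma0 l kl) expr0n invr0 mul0r mul0r addr0 scale0r.
  congr (_ *: _); rewrite muE; set z := (U^t* *m y) l 0.
  rewrite (_ : \sum_j _ = z); last by rewrite /z mxE.
  by rewrite rmorphM !fmorphV !rmorphXn /= -!exprVn; ring.
rewrite mulmxDr addrAC; apply: le_trans (fnormD _ _) _; apply: lerD.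
  by apply: svd_approximate_inverse; rewrite mulmxA XAX.
set q := delta * eps * fnorm b.
have q0 : 0 <= q by rewrite !mulr_ge0 ?fnorm_ge0 // ltW.
rewrite -(@ler_pXn2r _ 2) ?nnegrE ?fnorm_ge0 //; last by rewrite mulr_ge0 //; lra.
have f0 (l : 'I_r) : sigma l = 0 -> f l 0 = 0.
  by move=> s0; rewrite mxE s0 expr0n invr0 mulr0 if_same.
apply: le_trans (fnorm_coefficient_error f0) _.
have kR : 0 < k%:R :> R by rewrite ltr0n.
have sum_le : \sum_(l < r) sigma l ^+ 2 * ComplexField.Normc.normc (f l 0) ^+ 2 <= q ^+ 2.
  apply: (le_trans (y := \sum_(l < r) if (l < k)%N then q ^+ 2 / k%:R else 0)).
    apply: ler_sum => l _; rewrite mxE; case: ifP => lk; last first.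
      by rewrite ComplexField.Normc.normc0 expr0n mulr0.
    have [s0|s0] := eqVneq (sigma l) 0.
      by rewrite s0 expr0n mul0r divr_ge0 ?sqr_ge0 ?ltW.
    have s_gt0 : 0 < sigma l by rewrite lt_def s0 sigma_ge0.
    have normV : ComplexField.Normc.normc ((sigma l)%:C ^+ 3)^-1 = (sigma l ^+ 3)^-1.
      rewrite -rmorphXn -fmorphV /= expr0n addr0 sqrtr_sqr ger0_norm //.
      by rewrite invr_ge0 exprn_ge0 // ltW.
    rewrite ComplexField.Normc.normcM normV -exprMn.
    rewrite -[k%:R]sqr_sqrtr ?ler0n // -expr_div_n.
    have := lambdaE l lk.
    have : 0 <= ComplexField.Normc.normc (lambda l - mu l).
      by case: (_ - _) => ? ?; exact: sqrtr_ge0.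
    move: (ComplexField.Normc.normc _) => d d0 d_le.
    apply: lerXn2r; rewrite ?nnegrE.
    - by rewrite mulr_ge0 ?divr_ge0 ?exprn_ge0 ?(ltW s_gt0).
    - by rewrite divr_ge0 ?sqrtr_ge0.
    have -> : sigma l * (d / sigma l ^+ 3) = d / sigma l ^+ 2 by field.
    rewrite ler_pdivrMr ?exprn_gt0 //; apply: le_trans d_le _.
    by rewrite le_eqVlt; apply/orP; left; apply/eqP; rewrite /q; ring.
  rewrite -big_mkcond /= sumr_const -[leLHS]mulr_natr -mulrA ler_piMr ?sqr_ge0 //.
  rewrite mulrC ler_pdivrMr // mul1r ler_nat.
  (* The indices below both [r] and [k] inject into [iota 0 k], which bounds their number by [k]
     whichever of the two is smaller. *)
  rewrite cardE -(size_map val) -[leqRHS](size_iota 0).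
  apply: uniq_leq_size => [|i /mapP[l]].
    by rewrite map_inj_uniq ?enum_uniq //; exact: val_inj.
  by rewrite mem_enum mem_iota => lk ->.
have q2 : 0 <= q ^+ 2 by exact: sqr_ge0.
rewrite exprMn; lra.
Qed.

End Perturbation.

(** * Consequences of the Penrose equations *)

Section RankBound.
Context {R : realType}.
Local Notation C := R[i].

(** Cancelling the full-rank factors in [P P = P] shows that [row_base P *m col_base P] is the
    identity of size [\rank P], and it has the same trace as [P]. *)
Lemma mxtrace_idempotent n (P : 'M[C]_n) : P *m P = P -> \tr P = (\rank P)%:R.
Proof.
move=> PP; have baseK : row_base P *m col_base P = 1%:M.
  apply: (row_free_inj (row_base_free P)); apply: (row_full_inj (col_base_full P)).
  by rewrite mul1mx -mulmxA mulmxA !mulmx_base.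
by rewrite -{1}(mulmx_base P) mxtrace_mulC baseK mxtrace1.
Qed.

(** [P = A X] is an orthogonal projection with [A^* = A^* P], so [|A| <= |P|] in Frobenius norm, and
    [|P| ^ 2] is the trace of [P], that is, its rank. *)
Lemma fnorm_sqr_le_rank m n (A : 'M[C]_(m, n)) (X : 'M[C]_(n, m)) :
    is_pinv A X -> (forall x : 'cV_n, fnorm (A *m x) <= fnorm x) ->
  fnorm A ^+ 2 <= (\rank A)%:R.
Proof.
move=> [AXA _ AXt _] A_le; set P := A *m X in AXt.
have PP : P *m P = P by rewrite /P mulmxA AXA.
have AtP : A^t* = A^t* *m P by rewrite -{1}AXA adjmxM AXt.
have AP : fnorm A <= fnorm P.
  rewrite -fnorm_adj AtP -[leRHS]mul1r; apply: fnorm_mul_cols => // x.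
  by apply: fnorm_adj_le => // y; rewrite mul1r A_le.
apply: (le_trans (y := fnorm P ^+ 2)); first by rewrite ler_pXn2r ?nnegrE ?fnorm_ge0.
rewrite fnorm_sqr /rdot AXt PP (mxtrace_idempotent PP).
by rewrite -(rmorph_nat (real_complex R)) /= ler_nat mxrankM_maxl.
Qed.

(** A nonzero column [a] of [A] satisfies [a = A X a], hence [|a| <= |X a| <= K |a|]. *)
Lemma pinv_bound_ge1 m n (A : 'M[C]_(m, n)) (X : 'M[C]_(n, m)) (K : R) :
    is_pinv A X -> 0 < fnorm A -> (forall x : 'cV_n, fnorm (A *m x) <= fnorm x) ->
    (forall y : 'cV_m, fnorm (X *m y) <= K * fnorm y) ->
  1 <= K.
Proof.
move=> [AXA _ _ _] A0 A_le X_le.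
have [j Aj] : exists j, 0 < fnorm (col j A).
  apply/existsP; apply: contraTT A0; rewrite negb_exists => /forallP A0.
  suff -> : fnorm A = 0 by rewrite ltxx.
  apply/eqP; rewrite -sqrf_eq0 fnorm_sqr_cols big1 // => j _.
  have := A0 j; rewrite -leNgt => A0j; apply/eqP; rewrite sqrf_eq0.
  by rewrite eq_le A0j fnorm_ge0.
rewrite -(ler_pM2r Aj) mul1r; apply: le_trans (X_le _).
by rewrite -{1}AXA !colE -!mulmxA A_le.
Qed.

(** The difference is [A X (b - p)], which lies in the range of [A]; its squared norm is its inner
    product with [b - p], which is 0. *)
Lemma orth_proj_pinv m n (A : 'M[C]_(m, n)) (X : 'M[C]_(n, m)) (b p : 'cV[C]_m) :
  is_pinv A X -> is_orth_proj A b p -> p = A *m X *m b.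
Proof.
move=> [AXA _ AXt _] [[y py] orth].
have AXp : A *m X *m p = p by rewrite py mulmxA AXA.
apply/esym/eqP; rewrite -subr_eq0 -[X in _ - X]AXp -mulmxBr; apply/eqP/fnorm_eq0/eqP.
rewrite -sqrf_eq0 fnorm_sqr rdot_adjr AXt -mulmxA [X in rdot X](_ : _ = A *m (X *m (b - p))).
  by rewrite /rdot trace_mx11 [X in complex.Re X]orth.
by rewrite !mulmxA AXA.
Qed.

End RankBound.

(** * The sample counts meet the tail bounds *)

Section SampleCounts.
Context {R : realType}.
Local Notation C := R[i].

(** [expR (1 / 4) <= 4 / 3] because [expR (- 1 / 4) >= 3 / 4], and
    [expR (- q) <= eta / (8 N) <= eta / 8]; the product is at most [eta / 6]. *)
Lemma expR_tail_le (q N eta : R) : 0 < eta -> 1 <= N -> ln (8 * N / eta) <= q ->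
  expR (4^-1 - q) <= eta / 2.
Proof.
move=> eta0 N1 Lq.
have e4 : expR (4^-1) <= 4 / 3 :> R.
  have := expR_ge1Dx (- 4^-1 : R); rewrite expRN => h.
  rewrite -[leLHS]invrK (_ : 4 / 3 = (3 / 4)^-1); last by field.
  rewrite lef_pV2 ?posrE ?invr_gt0 ?expR_gt0 //; lra.
have q_le : expR (- q) <= eta / 8.
  apply: (le_trans (y := expR (- ln (8 * N / eta)))); first by rewrite ler_expR lerN2.
  have N8 : 0 < 8 * N / eta by rewrite divr_gt0 //; lra.
  rewrite expRN lnK ?posrE // invf_div ler_pM2l // lef_pV2 ?posrE; lra.
rewrite expRD; apply: (le_trans (y := 4 / 3 * (eta / 8))); last by lra.
by apply: ler_pM; rewrite ?expR_ge0.
Qed.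

Lemma le_absz_ceil (x : R) : 0 <= x -> x <= (`|Num.ceil x|%N)%:R.
Proof.
move=> x0; rewrite natr_absz ger0_norm ?ceil_ge //.
by rewrite ceil_ge0 (lt_le_trans _ x0) // ltrN10.
Qed.

Variables (m n : nat) (A : 'M[C]_(m, n)) (k : nat) (kappa eps eta : R).
Local Notation a := (fnorm A).
Local Notation r := (num_rows A k kappa eps eta).
Local Notation c := (num_cols A k kappa eps eta).

Hypothesis a_gt0 : 0 < a.
Hypothesis k_gt0 : (0 < k)%N.
Hypothesis kappa_gt0 : 0 < kappa.
Hypothesis eps_gt0 : 0 < eps.
Hypothesis eta01 : 0 < eta < 1.

Let kR : 0 < k%:R :> R. Proof. by rewrite ltr0n. Qed.

Lemma ln_gt0_count (N : nat) : (0 < N)%N -> 0 < ln (8 * N%:R / eta).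
Proof.
case/andP: eta01 => eta0 eta1 N0; rewrite ln_gt0 // ltr_pdivlMr //.
have : 1 <= N%:R :> R by rewrite ler1n.
lra.
Qed.

Lemma dim_gt0 : (0 < n)%N.
Proof.
case: (posnP n) => // n0; have := a_gt0.
suff -> : fnorm A = 0 by rewrite ltxx.
apply/eqP; rewrite -sqrf_eq0 fnorm_sqr_cols big1 // => j.
by have jn := ltn_ord j; rewrite [X in (_ < X)%N]n0 in jn.
Qed.

Lemma num_rows_ge :
  2 ^+ 10 * ln (8 * n%:R / eta) * kappa ^+ 4 * k%:R ^+ 2 * a ^+ 2 / eps ^+ 2 <= r%:R.
Proof.
have := ln_gt0_count dim_gt0 => L0; apply: le_absz_ceil.
by rewrite !mulr_ge0 ?invr_ge0 ?exprn_ge0 // ltW.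
Qed.

Lemma num_rows_gt0 : (0 < r)%N.
Proof.
rewrite -(ltr0n R); apply: lt_le_trans num_rows_ge.
have L0 := ln_gt0_count dim_gt0.
by rewrite !mulr_gt0 ?invr_gt0 ?exprn_gt0.
Qed.

Lemma num_cols_ge :
  2 ^+ 6 * 3 ^+ 4 * ln (8 * r%:R / eta) * kappa ^+ 8 * k%:R ^+ 2 * a ^+ 2 / eps ^+ 2
    <= c%:R.
Proof.
have := ln_gt0_count num_rows_gt0 => L0; apply: le_absz_ceil.
by rewrite !mulr_ge0 ?invr_ge0 ?exprn_ge0 // ltW.
Qed.

Lemma num_cols_gt0 : (0 < c)%N.
Proof.
rewrite -(ltr0n R); apply: lt_le_trans num_cols_ge.
have L0 := ln_gt0_count num_rows_gt0.
by rewrite !mulr_gt0 ?invr_gt0 ?exprn_gt0.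
Qed.

(* The accuracies at which the tail exponents of the two sampling steps reach
   [ln (8 n / eta)] and [ln (8 r / eta)]. *)
Definition row_error := eps * a / (5 * kappa ^+ 2 * k%:R).
Definition col_error := eps * a / (12 * kappa ^+ 4 * k%:R).

Lemma row_tail_le :
  expR (4^-1 - row_error ^+ 2 * r%:R / (32 * a ^+ 4)) <= eta / 2.
Proof.
case/andP: (eta01) => eta0 _; apply: (@expR_tail_le _ n%:R) => //.
  by rewrite ler1n dim_gt0.
have L0 := ln_gt0_count dim_gt0; set L := ln _ in L0 *.
(* Here [800 = 5 ^ 2 * 32], which is below the factor [2 ^ 10] of the row count. *)
set w := eps ^+ 2 / (800 * kappa ^+ 4 * k%:R ^+ 2 * a ^+ 2).
rewrite (_ : _ / _ = r%:R * w); last first.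
  by rewrite /w /row_error; field; rewrite !gt_eqF.
have w0 : 0 < w by rewrite divr_gt0 ?mulr_gt0 ?exprn_gt0.
apply: le_trans (ler_wpM2r (ltW w0) num_rows_ge).
rewrite -/L (_ : _ * w = 1024 / 800 * L); first by lra.
by rewrite /w; field; rewrite !gt_eqF.
Qed.

Lemma col_tail_le :
  expR (4^-1 - col_error ^+ 2 * c%:R / (32 * a ^+ 4)) <= eta / 2.
Proof.
case/andP: (eta01) => eta0 _; apply: (@expR_tail_le _ r%:R) => //.
  by rewrite ler1n num_rows_gt0.
have L0 := ln_gt0_count num_rows_gt0; set L := ln _ in L0 *.
(* Here [4608 = 12 ^ 2 * 32], which is below the factor [2 ^ 6 * 3 ^ 4 = 5184] of the column
   count. *)
set w := eps ^+ 2 / (4608 * kappa ^+ 8 * k%:R ^+ 2 * a ^+ 2).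
rewrite (_ : _ / _ = c%:R * w); last first.
  by rewrite /w /col_error; field; rewrite !gt_eqF.
have w0 : 0 < w by rewrite divr_gt0 ?mulr_gt0 ?exprn_gt0.
apply: le_trans (ler_wpM2r (ltW w0) num_cols_ge).
rewrite -/L (_ : _ * w = 5184 / 4608 * L); first by lra.
by rewrite /w; field; rewrite !gt_eqF.
Qed.

End SampleCounts.

(** * Sketches as matrix products, and the empty sample *)

Section Factorization.
Context {R : realType}.
Local Notation C := R[i].

Lemma row_sketch_factor m n (A : 'M[C]_(m, n)) r (I : {ffun 'I_r -> 'I_m}) :
  exists M : 'M[C]_(r, m), row_sketch A I = M *m A.
Proof.
exists (\matrix_(s, i) if i == I s
  then (fnorm A / Num.sqrt r%:R / fnorm (row (I s) A))%:C else 0).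
apply/matrixP => s j; rewrite !mxE (bigD1 (I s)) //= big1 ?addr0 => [|i iI].
  by rewrite mxE eqxx.
by rewrite mxE (negPf iI) mul0r.
Qed.

Lemma col_sketch_factor r n (a : R) (S : 'M[C]_(r, n)) c (J : {ffun 'I_c -> 'I_n}) :
  exists M : 'M[C]_(n, c), col_sketch a S J = S *m M.
Proof.
exists (\matrix_(j, t) if j == J t
  then (a / Num.sqrt c%:R / fnorm (col (J t) S))%:C else 0).
apply/matrixP => s t; rewrite !mxE (bigD1 (J t)) //= big1 ?addr0 => [|j jJ].
  by rewrite mxE eqxx mulrC.
by rewrite mxE (negPf jJ) mulr0.
Qed.

(** For the case [A = 0]: there [row_prob] sums to 0, but both sample counts are 0 and the single
    empty draw has weight 1. *)
Lemma sample_prob_total m n (A : 'M[C]_(m, n)) r c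
    (E : {ffun 'I_r -> 'I_m} -> {ffun 'I_c -> 'I_n} -> Prop) :
  r = 0%N -> c = 0%N -> (forall I J, E I J) -> sample_prob A E = 1.
Proof.
move=> r0 c0 EIJ; subst r c; rewrite /sample_prob.
rewrite (eq_bigr (fun=> 1)) => [|I _]; last first.
  rewrite (eq_bigl xpredT) => [|J]; last by apply/asboolP.
  rewrite big_ord0 (eq_bigr (fun=> 1)) => [|J _]; last by rewrite big_ord0 mulr1.
  by rewrite sumr_const card_ffun !card_ord expn0.
by rewrite sumr_const card_ffun !card_ord expn0.
Qed.

End Factorization.

(** * From small sketching errors to the accuracy guarantee *)

Section Main.
Context {R : realType}.
Local Notation C := R[i].

(** Since [p = A X b], [c0 |b| <= |p| <= |X b|]. The coefficient error is then at most
    [11 / 100 * eps |X b|], which fits beside the inversion error [4 / 5 * eps |X b|]. *)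
Lemma sketch_accuracy m n (A : 'M[C]_(m, n)) (X : 'M[C]_(n, m)) (b p : 'cV[C]_m)
    (eps c0 K : R) (k r c : nat) (I : {ffun 'I_r -> 'I_m}) (J : {ffun 'I_c -> 'I_n})
    (x : 'cV[C]_n) :
    is_pinv A X -> (forall x : 'cV_n, fnorm (A *m x) <= fnorm x) ->
    (forall y : 'cV_m, fnorm (X *m y) <= K * fnorm y) -> 1 <= K -> 0 < eps < 1 ->
    (\rank A <= k)%N -> (1 <= k)%N -> 0 < c0 ->
    is_orth_proj A b p -> c0 * fnorm b <= fnorm p ->
    fnorm ((row_sketch A I)^t* *m row_sketch A I - A^t* *m A) <= eps / (5 * K ^+ 2) ->
    fnorm (col_sketch (fnorm A) (row_sketch A I) J
             *m (col_sketch (fnorm A) (row_sketch A I) J)^t*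
           - row_sketch A I *m (row_sketch A I)^t*) <= eps / (12 * K ^+ 4) ->
    possible_output A b k eps (c0 / 10) I J x ->
  fnorm (x - X *m b) <= eps * fnorm (X *m b).
Proof.
move=> pinvX A_le X_le K1 eps01 rankA k1 c0_gt0 orth c0b.
rewrite /possible_output.
have [M1 ->] := row_sketch_factor A I.
have [M2 ->] := col_sketch_factor (fnorm A) (M1 *m A) J.
move=> E1_le E2_le [U [sigma [V [lambda /= [svd lambdaE ->]]]]].
case/andP: (eps01) => eps0 _.
have K0 : K != 0 by rewrite gt_eqF // (lt_le_trans ltr01 K1).
have t1E : eps / (5 * K ^+ 2) * K ^+ 2 = eps / 5 by field.
have t2E : eps / (12 * K ^+ 4) * K ^+ 4 = eps / 12 by field.
have d0 : 0 <= c0 / 10 by rewrite divr_ge0 ?ltW.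
apply: le_trans (sketch_output_error pinvX A_le X_le K1 eps01 t1E t2E E1_le E2_le svd
  rankA k1 d0 lambdaE) _.
have pX : fnorm p <= fnorm (X *m b).
  by rewrite (orth_proj_pinv pinvX orth) -mulmxA A_le.
have bX : c0 * fnorm b * eps <= fnorm (X *m b) * eps.
  by rewrite ler_pM2r // (le_trans c0b).
have X0 : 0 <= eps * fnorm (X *m b) by rewrite mulr_ge0 ?fnorm_ge0 ?ltW.
lra.
Qed.

Lemma sketch_zero m n (A : 'M[C]_(m, n)) (X : 'M[C]_(n, m)) (b : 'cV[C]_m)
    (eps delta : R) (k r c : nat) (I : {ffun 'I_r -> 'I_m}) (J : {ffun 'I_c -> 'I_n})
    (x : 'cV[C]_n) :
    is_pinv A X -> fnorm A = 0 -> possible_output A b k eps delta I J x ->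
  fnorm (x - X *m b) <= eps * fnorm (X *m b).
Proof.
move=> [_ XAX _ _] A0 [U [sigma [V [lambda /= [_ _ ->]]]]].
have [M ->] := row_sketch_factor A I.
rewrite -XAX (fnorm_eq0 A0) !mulmx0 !mul0mx -[0 as X in X^t*]/0.
by rewrite trmx0 map_mx0 mul0mx subrr fnorm0 mulr0.
Qed.

End Main.

Theorem theorem1 (R : realType) (c0 : R) (hc0 : 0 < c0) :
  exists2 delta : R, 0 < delta &
  forall (m n : nat) (A : 'M[R[i]]_(m, n)) (Aplus : 'M[R[i]]_(n, m))
         (b p : 'cV[R[i]]_m) (eps eta : R) (k : nat) (kappa : R),
    0 < eps < 1 -> 0 < eta < 1 -> (1 <= k)%N -> 0 < kappa ->
    is_pinv A Aplus ->
    (\rank A <= k)%N -> opnorm A <= 1 -> opnorm Aplus <= kappa ->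
    is_orth_proj A b p -> c0 * fnorm b <= fnorm p ->
    1 - eta <=
      sample_prob A
        (fun (I : {ffun 'I_(num_rows A k kappa eps eta) -> 'I_m})
             (J : {ffun 'I_(num_cols A k kappa eps eta) -> 'I_n}) =>
           forall x : 'cV[R[i]]_n,
             possible_output A b k eps delta I J x ->
             fnorm (x - Aplus *m b) <= eps * fnorm (Aplus *m b)).
Proof.
exists (c0 / 10); first by rewrite divr_gt0.
move=> m n A X b p eps eta k kappa eps01 eta01 k1 kappa0 pinvX rankA A1 Xk orth c0b.
case/andP: (eps01) => eps0 eps1; case/andP: (eta01) => eta0 eta1.
have A_le (x : 'cV_n) : fnorm (A *m x) <= fnorm x.
  by rewrite -[leRHS]mul1r fnorm_opnorm.
have X_le (y : 'cV_m) : fnorm (X *m y) <= kappa * fnorm y by exact: fnorm_opnorm.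
have [A0|A_neq0] := eqVneq (fnorm A) 0.
  rewrite sample_prob_total; first by rewrite gerBl ltW.
  - by rewrite /num_rows A0 expr0n mulr0 mul0r ceil0.
  - by rewrite /num_cols A0 expr0n mulr0 mul0r ceil0.
  - by move=> I J x; exact: sketch_zero.
have A0 : 0 < fnorm A by rewrite lt_def A_neq0 fnorm_ge0.
have K1 : 1 <= kappa := pinv_bound_ge1 pinvX A0 A_le X_le.
have kR : 0 < k%:R :> R by rewrite ltr0n.
(* From [|A| ^ 2 <= k <= k ^ 2] follows [|A| / k <= 1], which turns the accuracies [row_error] and
   [col_error] into those of [sketch_accuracy]. *)
have a_le_k : fnorm A <= k%:R.
  have a2 : fnorm A ^+ 2 <= k%:R.
    by apply: le_trans (fnorm_sqr_le_rank pinvX A_le) _; rewrite ler_nat.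
  rewrite -(@ler_pXn2r _ 2) ?nnegrE ?fnorm_ge0 ?ler0n //.
  by apply: le_trans a2 _; rewrite -natrX ler_nat expnS expn1 leq_pmulr.
set t1 := row_error A k kappa eps; set t2 := col_error A k kappa eps.
have t1_ge0 : 0 <= t1.
  by rewrite /t1 /row_error !mulr_ge0 ?invr_ge0 ?mulr_ge0 ?sqr_ge0 ?ler0n ?fnorm_ge0 ?ltW.
have t2_ge0 : 0 <= t2.
  by rewrite /t2 /col_error !mulr_ge0 ?invr_ge0 ?mulr_ge0 ?exprn_ge0 ?ler0n ?fnorm_ge0 ?ltW.
have ak : fnorm A / k%:R <= 1 by rewrite ler_pdivrMr // mul1r.
have t1_le : t1 <= eps / (5 * kappa ^+ 2).
  rewrite [t1](_ : _ = eps / (5 * kappa ^+ 2) * (fnorm A / k%:R)).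
    by rewrite ler_piMr // divr_ge0 ?mulr_ge0 ?exprn_ge0 ?(ltW eps0) ?(ltW kappa0).
  by rewrite /t1 /row_error; field; rewrite !gt_eqF.
have t2_le : t2 <= eps / (12 * kappa ^+ 4).
  rewrite [t2](_ : _ = eps / (12 * kappa ^+ 4) * (fnorm A / k%:R)).
    by rewrite ler_piMr // divr_ge0 ?mulr_ge0 ?exprn_ge0 ?(ltW eps0) ?(ltW kappa0).
  by rewrite /t2 /col_error; field; rewrite !gt_eqF.
have r0 := num_rows_gt0 A0 k1 kappa0 eps0 eta01.
have c0' := num_cols_gt0 A0 k1 kappa0 eps0 eta01.
(* The algorithm scales the columns by the norm of [A]; this equality lets [col_sketch_adj] treat it
   as the norm of the row sketch. *)
have S_norm (I : {ffun 'I_(num_rows A k kappa eps eta) -> 'I_m}) :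
    (forall s, fnorm (row (I s) A) != 0) -> fnorm ((row_sketch A I)^t*) = fnorm A.
  by move=> I0; rewrite fnorm_adj fnorm_row_sketch.
apply: (@sample_prob_ge _ _ _ _ _ _ _
  (fun I => fnorm ((row_sketch A I)^t* *m row_sketch A I - A^t* *m A) <= t1)
  (fun I J => fnorm ((row_sketch ((row_sketch A I)^t*) J)^t*
                       *m row_sketch ((row_sketch A I)^t*) J
                     - (row_sketch A I)^t*^t* *m (row_sketch A I)^t*) <= t2)) => //.
- move=> I J I0 good1 good2 x.
  apply: sketch_accuracy eps01 rankA k1 hc0 orth c0b _ _ => //.
    exact: le_trans good1 t1_le.
  rewrite -(S_norm I I0) fnorm_adj col_sketch_adj trmxCK.
  by apply: le_trans t2_le; rewrite trmxCK in good2.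
- exact: le_trans (row_sketch_tail A0 r0 t1_ge0) (row_tail_le A0 k1 kappa0 eps0 eta01).
- move=> I I0; have S0 : 0 < fnorm ((row_sketch A I)^t*) by rewrite S_norm.
  apply: le_trans (row_sketch_tail S0 c0' t2_ge0) _; rewrite S_norm //.
  exact: col_tail_le.
Qed.
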